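(* Let $\pi\in\Pi(\mu,\nu)$ be a coupling between the measures $\mu$ and $\nu$ on $\mathbb{R}^d$ with the property that there exists a constant $\Delta<\infty$ such that $$\int\frac12|x-y|^2\,d\pi\le\int\frac12|x-y|^2\,d\widetilde\pi+\Delta$$ for any $\widetilde\pi\in\Pi(\mu,\nu)$, and let $(\rho,j)$ be its Eulerian description. Then $$\int\frac12|x-y|^2\,d\pi\le\frac12\int\frac1\rho|j|^2+\Delta,$$ and $$\frac12\int\frac1\rho|j|^2\le\frac12\int\frac1{\widetilde\rho}|\widetilde j|^2+\Delta$$ for any pair of measures $(\widetilde\rho,\widetilde j)$ satisfying $$\int\left(\partial_t\zeta\,d\widetilde\rho+\nabla\zeta\cdot d\widetilde j\right)=\int\zeta_1\,d\nu-\int\zeta_0\,d\mu\qquad\text{for all }\zeta\in\mathcal{C}_c^\infty(\mathbb{R}^d\times[0,1]).$$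
   Context: $\Pi(\mu,\nu)$ is the set of couplings of $\mu,\nu$. Eulerian description of $\pi$: $(\rho,j)=(\rho_t\,dt,j_t\,dt)$ on $\mathbb{R}^d\times[0,1]$ given by $\int\zeta\,d\rho_t=\int\zeta((1-t)x+ty)\,d\pi$ and $\int\xi\cdot dj_t=\int\xi((1-t)x+ty)\cdot(y-x)\,d\pi$ for $t\in[0,1]$ and continuous compactly supported functions $\zeta$ and vector fields $\xi$. Density-flux pairs $(\widetilde\rho,\widetilde j)$ consist of a (non-negative) measure and an $\mathbb{R}^d$-valued measure on $\mathbb{R}^d\times[0,1]$; $\zeta_t:=\zeta(\cdot,t)$. The Eulerian cost is $$\frac12\int\frac1\rho|j|^2:=\sup_{\xi\in\mathcal{C}^0_c(\mathbb{R}^d\times[0,1])^d}\int\xi\cdot dj-\frac{|\xi|^2}2\,d\rho$$ (equal to $\frac12\int|\frac{dj}{d\rho}|^2d\rho$ if $j\ll\rho$). *)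

(* Defs.v *)
From HB Require Import structures.
From mathcomp Require Import all_boot all_order all_algebra.
From mathcomp Require Import all_classical all_reals all_analysis.

Set Implicit Arguments.
Unset Strict Implicit.
Unset Printing Implicit Defensive.

Import Order.TTheory GRing.Theory Num.Theory.
Import numFieldNormedType.Exports.

Local Open Scope classical_set_scope.
Local Open Scope ring_scope.

(** R^d is ['rV[R]_d] with its Borel sigma-algebra. The norm that the library
    puts on ['rV[R]_d] is the sup norm, so the Euclidean structure is given by
    [dotv] and [sqnorm] below. *)
HB.instance Definition _ (R : realType) (d : nat) :=
  @isMeasurable.Build (sigma_display (@open 'rV[R]_d)) 'rV[R]_d <<s open >>
    (@sigma_algebra0 _ setT open) (@sigma_algebraC _ open)
    (@sigma_algebra_bigcup _ setT open).

Definition dotv (R : realType) (d : nat) (u v : 'rV[R]_d) : R :=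
  \sum_(i < d) u ord0 i * v ord0 i.

Definition sqnorm (R : realType) (d : nat) (u : 'rV[R]_d) : R := dotv u u.

(** Measures on R^d x [0,1] are represented by measures on R^d x R of which
    only the restriction to [strip] is ever used. *)
Definition strip (R : realType) (d : nat) : set ('rV[R]_d * R) :=
  [set: 'rV[R]_d] `*` `[0, 1].

Definition Cc (R : realType) (T : topologicalType) (W : normedModType R)
    (D : set T) : set (T -> W) :=
  [set f | {within D, continuous f} /\
    exists K : set T, [/\ compact K, K `<=` D & forall x, D x -> ~ K x -> f x = 0]].

Fixpoint iter_derive (R : realType) (V W : normedModType R) (vs : seq V)
    (f : V -> W) : V -> W :=
  if vs is v :: vs' then 'D_v (iter_derive vs' f) else f.

(** C^oo: iterated directional derivatives of every order exist and are
    continuous. *)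
Definition smooth (R : realType) (V W : normedModType R) (f : V -> W) : Prop :=
  forall vs : seq V, continuous (iter_derive vs f) /\
    forall x v, derivable (iter_derive vs f) x v.

(** Elements of C_c^oo(R^d x [0,1]) need not vanish at times 0 and 1; they are
    the restrictions to the strip of the elements of C_c^oo(R^d x R). *)
Definition Cc_smooth (R : realType) (d : nat) : set ('rV[R]_d * R -> R) :=
  [set zeta | smooth (W := R^o) zeta /\ Cc (W := R^o) setT zeta].

Definition locally_finite (R : realType) (T : topologicalType) (D : set T)
    (m : set T -> \bar R) : Prop :=
  forall K : set T, compact K -> K `<=` D -> (m K < +oo)%E.

(** R^d-valued measures, each component being the difference of two
    non-negative measures. A flux is only paired with compactly supported
    fields and may have infinite total variation, in which case its components
    are not of type [{charge set T -> \bar R}], since charges take only finite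
    values. Local finiteness is required separately, by
    [locally_finite_flux]. *)
Record vmeasure (R : realType) (d : nat) (disp : measure_display)
    (T : measurableType disp) := VMeasure {
  vpos : 'I_d -> {measure set T -> \bar R};
  vneg : 'I_d -> {measure set T -> \bar R} }.

Definition locally_finite_flux (R : realType) (d : nat) (T : topologicalType)
    (D : set T) (jpos jneg : 'I_d -> set T -> \bar R) : Prop :=
  forall i, locally_finite D (jpos i) /\ locally_finite D (jneg i).

Definition time_derivative (R : realType) (d : nat) (zeta : 'rV[R]_d * R -> R)
    (z : 'rV[R]_d * R) : R :=
  'D_((0 : 'rV[R]_d), (1 : R)) (zeta : _ -> R^o) z.

Definition space_gradient (R : realType) (d : nat) (zeta : 'rV[R]_d * R -> R)
    (z : 'rV[R]_d * R) : 'rV[R]_d :=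
  \row_(i < d) 'D_((delta_mx ord0 i : 'rV[R]_d), (0 : R)) (zeta : _ -> R^o) z.

Local Open Scope ereal_scope.

(** The integral of xi . dj over D. *)
Definition vintegral (R : realType) (d : nat) (disp : measure_display)
    (T : measurableType disp) (j : vmeasure R d T) (D : set T)
    (xi : T -> 'rV[R]_d) : \bar R :=
  \sum_(i < d) (\int[vpos j i]_(x in D) (xi x ord0 i)%:E
              - \int[vneg j i]_(x in D) (xi x ord0 i)%:E).

Definition coupling (R : realType) (d : nat)
    (mu nu : {measure set 'rV[R]_d -> \bar R})
    (gam : {measure set ('rV[R]_d * 'rV[R]_d) -> \bar R}) : Prop :=
  forall A : set 'rV[R]_d, measurable A ->
    gam (A `*` setT) = mu A /\ gam (setT `*` A) = nu A.

Definition transport_cost (R : realType) (d : nat)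
    (gam : {measure set ('rV[R]_d * 'rV[R]_d) -> \bar R}) : \bar R :=
  \int[gam]_z (2^-1 * sqnorm (z.1 - z.2))%:E.

Definition density_flux (R : realType) (d : nat)
    (rho : {measure set ('rV[R]_d * R) -> \bar R})
    (j : vmeasure R d ('rV[R]_d * R)%type) : Prop :=
  locally_finite (@strip R d) rho /\
  locally_finite_flux (@strip R d) (vpos j) (vneg j).

(** The cost 1/2 int |j|^2 / rho, in its dual form. *)
Definition eulerian_cost (R : realType) (d : nat)
    (rho : {measure set ('rV[R]_d * R) -> \bar R})
    (j : vmeasure R d ('rV[R]_d * R)%type) : \bar R :=
  ereal_sup [set vintegral j (@strip R d) xi
                 - \int[rho]_(z in @strip R d) (sqnorm (xi z) / 2)%:E
            | xi in Cc (W := 'rV[R]_d) (@strip R d)].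

Definition interp (R : realType) (d : nat) (t : R)
    (z : 'rV[R]_d * 'rV[R]_d) : 'rV[R]_d :=
  ((1 - t) *: z.1 + t *: z.2)%R.

Definition slice_description (R : realType) (d : nat)
    (gam : {measure set ('rV[R]_d * 'rV[R]_d) -> \bar R}) (t : R)
    (rho_t : {measure set 'rV[R]_d -> \bar R})
    (j_t : vmeasure R d 'rV[R]_d) : Prop :=
  [/\ locally_finite setT rho_t,
      locally_finite_flux setT (vpos j_t) (vneg j_t),
      forall zeta : 'rV[R]_d -> R, Cc (W := R^o) setT zeta ->
        \int[rho_t]_x (zeta x)%:E = \int[gam]_z (zeta (interp t z))%:E
    & forall xi : 'rV[R]_d -> 'rV[R]_d, Cc setT xi ->
        vintegral j_t setT xi
        = \int[gam]_z (dotv (xi (interp t z)) (z.2 - z.1))%:E].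

(** (rho, j) = (rho_t dt, j_t dt). *)
Definition eulerian_description (R : realType) (d : nat)
    (gam : {measure set ('rV[R]_d * 'rV[R]_d) -> \bar R})
    (rho : {measure set ('rV[R]_d * R) -> \bar R})
    (j : vmeasure R d ('rV[R]_d * R)%type) : Prop :=
  density_flux rho j /\
  exists (rho_ : R -> {measure set 'rV[R]_d -> \bar R})
         (j_ : R -> vmeasure R d 'rV[R]_d),
    [/\ forall t, (0 <= t <= 1)%R -> slice_description gam t (rho_ t) (j_ t),
        forall zeta : 'rV[R]_d * R -> R, Cc (W := R^o) (@strip R d) zeta ->
          \int[rho]_(z in @strip R d) (zeta z)%:E
          = \int[@lebesgue_measure R]_(t in `[0%R, 1%R])
              \int[rho_ t]_x (zeta (x, t))%:E
      & forall xi : 'rV[R]_d * R -> 'rV[R]_d, Cc (@strip R d) xi ->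
          vintegral j (@strip R d) xi
          = \int[@lebesgue_measure R]_(t in `[0%R, 1%R])
              vintegral (j_ t) setT (fun x => xi (x, t))].

(** The continuity equation with initial value mu and final value nu. *)
Definition continuity_equation (R : realType) (d : nat)
    (mu nu : {measure set 'rV[R]_d -> \bar R})
    (rho : {measure set ('rV[R]_d * R) -> \bar R})
    (j : vmeasure R d ('rV[R]_d * R)%type) : Prop :=
  forall zeta : 'rV[R]_d * R -> R, Cc_smooth zeta ->
    \int[rho]_(z in @strip R d) (time_derivative zeta z)%:E
    + vintegral j (@strip R d) (space_gradient zeta)
    = \int[nu]_y (zeta (y, 1%R))%:E - \int[mu]_x (zeta (x, 0%R))%:E.

(* Main.v *)
Require Import Defs.
From HB Require Import structures.
From mathcomp Require Import all_boot all_order all_algebra.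
From mathcomp Require Import all_classical all_reals all_analysis.
From mathcomp Require Import measurable_realfun.
From mathcomp Require Import ring lra.

(** The Eulerian cost of a solution of the continuity equation from [mu] to [nu]
    dominates the transport cost of suitable couplings: for every [eps > 0],
    [approximate_coupling] provides a coupling of transport cost at most the
    Eulerian cost plus [eps]. Almost minimality of [gam] then bounds its
    transport cost by the Eulerian cost of any solution plus [Delta]. The first
    inequality is this bound for [(rho, j)], which solves the continuity
    equation by [eulerian_continuity_equation]. The second one follows from this
    bound for [(rho', j')] together with [eulerian_cost_le_transport], according
    to which the Eulerian cost of [(rho, j)] is at most the transport cost of
    [gam].

    The couplings come from duality. A smooth compactly supported subsolution
    [f] of the Hamilton-Jacobi equation, [d_t f + |grad f|^2 / 2 <= 0], used as
    a test function in the continuity equation, shows that the difference of the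
    integrals of [f] at the final and at the initial time is at most the
    Eulerian cost ([hj_dual_bound]). On the other hand, Farkas' lemma yields a
    coupling of given weights on a finite set with cost at most [E] as soon as
    [E] bounds the dual functional at all pairs of admissible potentials
    ([finite_coupling]). Space is therefore cut into small cubes, all but
    finitely many of which are merged into one cell at cost zero from everything.
    Admissible potentials on the cells are turned into a subsolution by a soft
    minimum of quadratic functions ([hamilton_jacobi_test_function]), so that
    the dual functional is at most the Eulerian cost up to a small error
    ([level_dual]). As the number of cells grows, the finite couplings converge
    entry by entry along an ultrafilter; no mass is lost since the measures are
    finite ([countable_coupling]). Distributing the mass of a pair of cells
    proportionally to the product of [mu] and [nu] gives a coupling of [mu] and
    [nu] ([glued]).

    The statements about [(rho, j)] reduce to single segments by Fubini's theorem
    ([density_on_paths] and [flux_on_paths]). It applies to the flux even if the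
    transport cost is infinite, because a long segment crosses a bounded region
    quickly ([chord_integral]). *)

Set Implicit Arguments.
Unset Strict Implicit.
Unset Printing Implicit Defensive.
Import Order.TTheory GRing.Theory Num.Theory.
Import numFieldNormedType.Exports.
Local Open Scope classical_set_scope.
Local Open Scope ring_scope.

(** * Farkas' lemma and finite transport problems *)

(** Induction on the number of constraints. If the first [n] of them do not
    suffice, some [x0] satisfies these but has [c x0 > 0]; the last constraint
    must then be positive at [x0], and projecting all functionals along [x0]
    onto the kernel of the last one reduces to [n] constraints. *)
Lemma farkas (R : realFieldType) (K : finType) (n : nat) (a : nat -> K -> R)
    (c : K -> R) :
  (forall x : K -> R, (forall i, (i < n)%N -> \sum_k a i k * x k <= 0) ->
     \sum_k c k * x k <= 0) ->
  exists2 u : nat -> R, forall i, 0 <= u i &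
    forall k, c k = \sum_(i < n) u i * a i k.
Proof.
elim: n a c => [|n IH] a c Hc.
  exists (fun=> 0) => // k; rewrite big_ord0.
  have := Hc c (fun i => ltac:(by [])).
  have sq0 : forall i : K, true -> 0 <= c i * c i by move=> i _; exact: sqr_ge0.
  move=> le0; have /eqP : \sum_k c k * c k = 0.
    by apply/eqP; rewrite eq_le le0 sumr_ge0.
  rewrite psumr_eq0// => /allP/(_ k (mem_index_enum _))/=.
  by rewrite mulf_eq0 orbb => /eqP.
case: (pselect (forall x : K -> R,
    (forall i, (i < n)%N -> \sum_k a i k * x k <= 0) -> \sum_k c k * x k <= 0)).
  move=> /IH[u u0 uE]; exists (fun i => if i == n then 0 else u i).
    by move=> i; case: ifP.
  move=> k; rewrite big_ord_recr/= eqxx mul0r addr0 uE.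
  by apply: eq_bigr => i _; rewrite ltn_eqF.
move=> /existsNP[x0 /not_implyP[x0a /negP]]; rewrite -ltNge => x0c.
have an0 : 0 < \sum_k a n k * x0 k.
  rewrite ltNge; apply/negP => an0; move: x0c; rewrite ltNge; apply/negP/negPn.
  by apply: Hc => i; rewrite ltnS leq_eqVlt => /predU1P[->//|]; exact: x0a.
set N := \sum_k a n k * x0 k in an0.
(* Normalized so that the last constraint takes the value 1 at y0. *)
pose y0 k := x0 k / N.
have dotZ (b : K -> R) : \sum_k b k * y0 k = (\sum_k b k * x0 k) / N.
  by rewrite mulr_suml; apply: eq_bigr => k _; exact: mulrA.
pose e (b : K -> R) := \sum_k b k * y0 k.
have en : e (a n) = 1 by rewrite /e dotZ divff// gt_eqF.
have ei i : (i < n)%N -> e (a i) <= 0.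
  by move=> ?; rewrite /e dotZ pmulr_lle0 ?invr_gt0//; exact: x0a.
have ec : 0 <= e c by rewrite /e dotZ divr_ge0 ?ltW.
have expand (b x : K -> R) : \sum_k (b k - e b * a n k) * x k =
    \sum_k b k * (x k - (\sum_l a n l * x l) * y0 k).
  under eq_bigr do rewrite mulrBl -mulrA.
  under [RHS]eq_bigr do rewrite mulrBr mulrCA.
  by rewrite !sumrB -!mulr_sumr -/(e b) mulrC.
have [|u u0 uE] := IH (fun i k => a i k - e (a i) * a n k) (fun k => c k - e c * a n k).
  move=> x xle; rewrite expand; apply: Hc => i.
  rewrite ltnS leq_eqVlt => /predU1P[->|ilt]; last by rewrite -expand; exact: xle.
  by rewrite -expand en big1// => k _; rewrite mul1r subrr mul0r.
(* The last multiplier is nonnegative since [e c >= 0] and [e (a i) <= 0]. *)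
exists (fun i => if i == n then e c - \sum_(i < n) u i * e (a i) else u i).
  move=> i; case: ifP => // _; rewrite subr_ge0 (le_trans _ ec)//.
  by apply: sumr_le0 => j _; rewrite mulr_ge0_le0// ei.
move=> k; rewrite big_ord_recr/= eqxx.
under eq_bigr do rewrite ltn_eqF//.
have /= := uE k; under eq_bigr do rewrite mulrBr mulrA; rewrite sumrB -mulr_suml.
by lra.
Qed.

Lemma farkas_fin (R : realFieldType) (K J : finType) (a : J -> K -> R)
    (c : K -> R) :
  (forall x : K -> R, (forall i, \sum_k a i k * x k <= 0) ->
     \sum_k c k * x k <= 0) ->
  exists2 u : J -> R, forall i, 0 <= u i &
    forall k, c k = \sum_i u i * a i k.
Proof.
case: (pickP (@predT J)) => [j0 _|J0] H; last first.
  have [|u u0 uE] := @farkas R K 0 (fun=> c) c.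
    by move=> x _; apply: H => i; have := J0 i.
  exists (fun=> 0) => // k; rewrite uE big_ord0 big1// => i _.
  by rewrite mul0r.
have [x xle|u u0 uE] := @farkas R K #|J| (fun i => a (nth j0 (enum J) i)) c.
  apply: H => i; have := xle (enum_rank i) (ltn_ord _).
  by rewrite -(enum_val_nth j0) enum_rankK.
exists (fun i => u (enum_rank i)) => // k; rewrite uE.
rewrite (reindex (@enum_rank J))/=; last exact/onW_bij/enum_rank_bij.
by apply: eq_bigr => i _; rewrite -(enum_val_nth j0) enum_rankK.
Qed.

(** Duality for the transport problem between weights on a finite set. The
    unknowns of the Farkas alternative are the two potentials and a multiplier
    of the cost; a positive multiplier can be scaled to [1], and a vanishing one
    is ruled out by scaling the potentials up, as the cost is nonnegative. *)
Lemma finite_coupling (R : realFieldType) (I : finType) (m n : I -> R)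
    (c : I -> I -> R) (E : R) :
  (forall i j, 0 <= c i j) ->
  (forall phi psi : I -> R, (forall i j, psi j - phi i <= c i j) ->
     \sum_j psi j * n j - \sum_i phi i * m i <= E) ->
  exists p : I -> I -> R, [/\ forall i j, 0 <= p i j,
    forall i, \sum_j p i j = m i, forall j, \sum_i p i j = n j &
    \sum_i \sum_j p i j * c i j <= E].
Proof.
move=> c0 dual.
have dual_scaled (phi psi : I -> R) (l : R) : 0 <= l ->
    (forall i j, psi j - phi i <= l * c i j) ->
    \sum_j psi j * n j - \sum_i phi i * m i <= l * E.
  have scaleE k (f g : I -> R) : \sum_i k * f i * g i = k * \sum_i f i * g i.
    by rewrite mulr_sumr; apply: eq_bigr => i _; rewrite mulrA.
  rewrite le_eqVlt => /predU1P[<-|l0] phipsi; last first.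
    have := dual (fun i => l^-1 * phi i) (fun i => l^-1 * psi i).
    rewrite !scaleE -mulrBr ler_pdivrMl//; apply=> i j.
    by rewrite -mulrBr ler_pdivrMl.
  rewrite mul0r leNgt; apply/negP.
  set D := _ - _ => D0.
  pose k := (`|E| + 1) / D.
  have k0 : 0 <= k by rewrite /k divr_ge0// ltW.
  have := dual (fun i => k * phi i) (fun i => k * psi i).
  rewrite !scaleE -mulrBr -/D /k divfK ?gt_eqF//.
  have : E <= `|E| by exact: ler_norm.
  move=> ? /(_ _)/wrap[|]; last by lra.
  move=> i j; rewrite -mulrBr (le_trans _ (c0 i j))// mulr_ge0_le0//.
  by have := phipsi i j; rewrite mul0r.
(* Coordinates: the two potentials and the multiplier of the cost. The
   constraints are indexed by the pairs, [None] being the sign of the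
   multiplier. *)
pose K := (I + I + unit)%type.
pose a (o : option (I * I)) (k : K) : R := match o, k with
  | Some (i, j), inl (inl i') => - (i' == i)%:R
  | Some (i, j), inl (inr j') => (j' == j)%:R
  | Some (i, j), inr _ => - c i j
  | None, inl _ => 0
  | None, inr _ => -1 end.
pose g (k : K) : R := match k with
  | inl (inl i) => - m i | inl (inr j) => n j | inr _ => - E end.
have sumK (f : K -> R) : \sum_k f k =
    \sum_i f (inl (inl i)) + \sum_j f (inl (inr j)) + f (inr tt).
  by rewrite big_sumType/= big_sumType/= (big_pred1 tt)//; case.
have delta (f : I -> R) (i0 : I) : \sum_i (i0 == i)%:R * f i = f i0.
  rewrite (bigD1 i0)//= eqxx mul1r big1 ?addr0// => i.
  by rewrite eq_sym => /negPf ->; rewrite mul0r.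
have deltaC (f : I -> R) (i0 : I) : \sum_i (i == i0)%:R * f i = f i0.
  by rewrite -[RHS]delta; apply: eq_bigr => i _; rewrite eq_sym.
have [x xle|u u0 uE] := @farkas_fin R K _ a g.
  have l0 := xle None; have phipsi i j := xle (Some (i, j)).
  rewrite sumK/= !big1 in l0; do ?by move=> *; rewrite mul0r.
  rewrite sumK/=; under eq_bigr do rewrite mulNr mulrC.
  under [X in _ + X + _]eq_bigr do rewrite mulrC.
  have := @dual_scaled (fun i => x (inl (inl i))) (fun i => x (inl (inr i)))
    (x (inr tt)).
  rewrite sumrN => /(_ _ _)/wrap[||]; [by lra| |by lra].
  move=> i j; have := phipsi i j; rewrite sumK/=.
  under eq_bigr do rewrite mulNr.
  by rewrite sumrN !deltaC; lra.
have sumJ (f : option (I * I) -> R) :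
    \sum_o f o = f None + \sum_i \sum_j f (Some (i, j)).
  rewrite (bigD1 None)//=; congr (_ + _).
  rewrite pair_big/= (reindex_omap Some id)/=; last by case.
  by apply: eq_big => [[i j]|[i j]]; rewrite ?eqxx.
exists (fun i j => u (Some (i, j))); split => //.
- move=> i; have := uE (inl (inl i)); rewrite sumJ/= mulr0 add0r.
  under eq_bigr do under eq_bigr do rewrite mulrN mulrC.
  under eq_bigr do rewrite sumrN -mulr_sumr.
  by rewrite sumrN delta; lra.
- move=> j; have := uE (inl (inr j)); rewrite sumJ/= mulr0 add0r => ->.
  by apply: eq_bigr => i _; under eq_bigr do rewrite mulrC; rewrite delta.
- have := uE (inr tt); rewrite sumJ/= mulrN1.
  under eq_bigr do under eq_bigr do rewrite mulrN.
  under eq_bigr do rewrite sumrN.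
  by rewrite sumrN; have := u0 None; lra.
Qed.

(** * Smooth functions *)

(** Directional derivatives are derivatives along lines, which transfers the
    chain rule of one variable to them. *)
Lemma is_derive_line (R : realType) (V W : normedModType R) (f : V -> W)
    (x v : V) (df : W) :
  is_derive x v f df <-> is_derive (0 : R) 1 (fun h => f (h *: v + x)) df.
Proof.
have E : (fun h : R => h^-1 *: ((f \o shift x) (h *: v) - f x)) =
  (fun h : R => h^-1 *: (((fun k : R => f (k *: v + x)) \o shift 0) (h *: 1)
      - (fun k : R => f (k *: v + x)) 0)).
  by apply/funext => h /=; rewrite addr0 scale0r add0r [_%:A]mulr1.
split=> -[D1 D2]; apply: DeriveDef.
- by move: D1; rewrite /derivable E.
- by rewrite -D2 /derive E.
- by move: D1; rewrite /derivable E.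
- by rewrite -D2 /derive E.
Qed.

Lemma is_derive_comp_line (R : realType) (V : normedModType R) (f : V -> R)
    (h : R -> R) (x v : V) (df dh : R) :
  is_derive x v f df -> is_derive (f x) 1 h dh ->
  is_derive x v (h \o f) (dh * df).
Proof.
move=> /is_derive_line Df Dh; apply/is_derive_line.
apply: (@is_derive1_comp R h (fun k => f (k *: v + x)) 0) => //.
by rewrite scale0r add0r.
Qed.

(** Finite-order smoothness. Unlike [smooth], it lends itself to an induction on
    the order, because the derivative is taken first and not last. *)
Fixpoint Ck (R : realType) (V W : normedModType R) (n : nat) (f : V -> W) :=
  continuous f /\
  if n is n'.+1 then
    (forall x v, derivable f x v) /\ forall v, Ck n' ('D_v f)
  else True.

Section Ck_theory.
Context {R : realType} {V : normedModType R}.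
Implicit Types f g : V -> R^o.

Lemma Ck_continuous n f : Ck n f -> continuous f.
Proof. by case: n => [|n] []. Qed.

Lemma CkS n f (df : V -> V -> R^o) :
  continuous f -> (forall x v, is_derive x v f (df v x)) ->
  (forall v, Ck n (df v)) -> Ck n.+1 f.
Proof.
move=> cf Df Cdf; split=> //; split=> [x v|v].
  by have [] := Df x v.
rewrite (_ : 'D_v f = df v)//.
by apply/funext => x; exact: (@derive_val _ _ _ _ _ _ _ (Df x v)).
Qed.

Lemma CkW n f : Ck n.+1 f -> Ck n f.
Proof.
elim: n f => [|n IH] f [cf [df Cdf]]; first by split.
by split=> //; split=> // v; exact: IH.
Qed.

Lemma CkS_derive n f : Ck n.+1 f -> forall x v, is_derive x v f ('D_v f x).
Proof. by move=> [_ [df _]] x v; exact/derivableP. Qed.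

Lemma smooth_Ck f : (forall n, Ck n f) -> smooth (W := R^o) f.
Proof.
move=> Cf vs; move: (Cf (size vs).+1).
elim/last_ind: vs f {Cf} => [|vs v IH] f; first by move=> [cf [df _]].
rewrite size_rcons => -[_ [_ /(_ v)/IH]].
suff -> : iter_derive (rcons vs v) f = iter_derive vs ('D_v f) by [].
by elim: vs {IH} => [|w vs /= ->].
Qed.

Lemma Ck_cst n (c : R) : Ck n (fun _ : V => c : R^o).
Proof.
elim: n c => [|n IH] c; first by split => // x; exact: cvg_cst.
apply: (@CkS _ _ (fun _ _ => 0)) => //; move=> x; exact: cvg_cst.
Qed.

Lemma CkD n f g : Ck n f -> Ck n g -> Ck n (fun x => f x + g x : R^o).
Proof.
elim: n f g => [|n IH] f g Cf Cg.
  by split => // x; apply: cvgD; [exact: (Ck_continuous Cf)|exact: (Ck_continuous Cg)].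
apply: (@CkS _ _ (fun v x => 'D_v f x + 'D_v g x)).
- by move=> x; apply: cvgD; [exact: (Ck_continuous Cf)|exact: (Ck_continuous Cg)].
- by move=> x v; exact: (is_deriveD (CkS_derive Cf x v) (CkS_derive Cg x v)).
- by move=> v; apply: IH; [apply Cf|apply Cg].
Qed.

Lemma CkM n f g : Ck n f -> Ck n g -> Ck n (fun x => f x * g x : R^o).
Proof.
elim: n f g => [|n IH] f g Cf Cg.
  by split => // x; apply: cvgM; [exact: (Ck_continuous Cf)|exact: (Ck_continuous Cg)].
apply: (@CkS _ _ (fun v x => f x * 'D_v g x + g x * 'D_v f x)).
- by move=> x; apply: cvgM; [exact: (Ck_continuous Cf)|exact: (Ck_continuous Cg)].
- by move=> x v; exact: (is_deriveM (CkS_derive Cf x v) (CkS_derive Cg x v)).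
- move=> v; apply: CkD; apply: IH; do ?exact: CkW; [apply Cg|apply Cf].
Qed.

Lemma Ck_sum n (I : Type) (s : seq I) (F : I -> V -> R^o) :
  (forall i, Ck n (F i)) -> Ck n (fun x => \sum_(i <- s) F i x : R^o).
Proof.
move=> CF; elim: s => [|i s IH].
  have -> : (fun x => \sum_(i <- [::]) F i x) = (fun=> 0 : R^o).
    by apply/funext => x; rewrite big_nil.
  exact: Ck_cst.
have -> : (fun x => \sum_(j <- i :: s) F j x) =
    (fun x => F i x + \sum_(j <- s) F j x).
  by apply/funext => x; rewrite big_cons.
exact: CkD.
Qed.

(** A one-variable function smooth on a set [D] is given together with all its
    derivatives [H k], which makes the chain rule a plain induction. *)
Lemma Ck_comp n (D : set R) (H : nat -> R -> R) f k :
  (forall k s, D s -> {for s, continuous (H k)}) ->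
  (forall k s, D s -> is_derive s 1 (H k) (H k.+1 s)) ->
  (forall x, D (f x)) -> Ck n f -> Ck n (fun x => H k (f x) : R^o).
Proof.
move=> cH dH Df; elim: n k => [|n IH] k Cf.
  split => // x; apply: continuous_comp; first exact: (Ck_continuous Cf).
  exact: cH.
apply: (@CkS _ _ (fun v x => H k.+1 (f x) * 'D_v f x)).
- move=> x; apply: continuous_comp; first exact: (Ck_continuous Cf).
  exact: cH.
- move=> x v; apply: (@is_derive_comp_line _ _ f (H k)).
    exact: (CkS_derive Cf).
  exact: dH.
- by move=> v; apply: CkM; [apply: IH; exact: CkW|apply Cf].
Qed.

End Ck_theory.

(** * A smooth positive part *)

Section flat.
Context {R : realType} (kappa : R) (kappa0 : 0 < kappa).

(** Functions [p (1 / u) * exp (- kappa / u)], extended by [0] to [u <= 0]. The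
    family is stable under derivation, so that its members are smooth. *)
Definition flat (p : {poly R}) (u : R) : R :=
  if 0 < u then p.[u^-1] * expR (- kappa / u) else 0.

Definition flat_step (p : {poly R}) : {poly R} :=
  ('X^2 * (kappa *: p - p^`()))%R.

Lemma exprn_le_expR (n : nat) (s : R) : 0 <= s ->
  s ^+ n <= (n.+1%:R / kappa) ^+ n * expR (kappa * s).
Proof.
move=> s0; have N0 : 0 < n.+1%:R :> R by rewrite ltr0n.
pose t := kappa * s / n.+1%:R.
have t0 : 0 <= t by rewrite /t divr_ge0 ?mulr_ge0// ltW.
have st : s = n.+1%:R / kappa * t by rewrite /t; field; rewrite !gt_eqF ?ltr0n.
rewrite {1}st exprMn ler_wpM2l//; first by rewrite exprn_ge0// divr_ge0// ltW.
rewrite (@le_trans _ _ (expR t ^+ n))//.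
  by rewrite lerXn2r ?nnegrE ?expR_ge0// (le_trans _ (expR_ge1Dx _))// lerDr.
have -> : kappa * s = n.+1%:R * t by rewrite /t; field; rewrite gt_eqF.
by rewrite -expRM_natl ler_expR ler_wpM2r// -natr1 lerDl.
Qed.

Lemma flat_bounded (p : {poly R}) : exists2 C, 0 <= C &
  forall u, `|flat p u| <= C.
Proof.
exists (\sum_(i < size p) `|p`_i| * (i.+1%:R / kappa) ^+ i).
  apply: sumr_ge0 => i _; rewrite mulr_ge0// exprn_ge0// divr_ge0// ltW//.
move=> u; rewrite /flat; case: ifPn => u0; last first.
  rewrite normr0; apply: sumr_ge0 => i _.
  by rewrite mulr_ge0// exprn_ge0// divr_ge0// ltW.
rewrite normrM [`|expR _|]ger0_norm ?expR_ge0// mulNr expRN ler_pdivrMr ?expR_gt0//.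
rewrite horner_coef mulr_suml (le_trans (ler_norm_sum _ _ _))// ler_sum// => i _.
rewrite normrM -mulrA ler_wpM2l// ger0_norm ?exprn_ge0 ?invr_ge0 ?(ltW u0)//.
by apply: exprn_le_expR; rewrite invr_ge0 ltW.
Qed.

Lemma flat_mulX (p : {poly R}) u : u * flat (p * 'X) u = flat p u.
Proof.
rewrite /flat; case: ifPn => u0; last by rewrite mulr0.
by rewrite hornerM hornerX; field; rewrite gt_eqF.
Qed.

(** At [0] the difference quotient of [flat p] is [flat (p * 'X)], and two
    more factors ['X] show it to be at most a multiple of [`|h|]. *)
Lemma is_derive_flat (p : {poly R}) (u : R) :
  is_derive u (1 : R) (flat p) (flat (flat_step p) u).
Proof.
have [u0|u0|->] := ltgtP u 0.
- apply: (@near_eq_is_derive _ _ _ (cst 0)).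
    near=> z; rewrite /flat ifN// -leNgt.
    by apply: ltW; near: z; exact: lt_nbhsl.
  by rewrite /flat ifN -?leNgt ?ltW//; exact: is_derive_cst.
- apply: (@near_eq_is_derive R R R (fun z : R => p.[z^-1] * expR (- kappa * z^-1))).
    near=> z; rewrite /flat ifT//.
    by near: z; exact: lt_nbhsr.
  have u_neq0 : u != 0 by rewrite gt_eqF.
  have Di : is_derive u (1:R) (fun z : R => z^-1) (- u ^- 2).
    by apply: (is_derive_eq (is_deriveV u_neq0 (is_derive_id u 1))); exact: mulr1.
  have Dp := is_derive_poly p u^-1.
  rewrite /flat u0.
  have D1 := @is_derive1_comp _ (horner p) (fun z : R => z^-1) _ _ _ Dp Di.
  have Dk : is_derive u (1 : R) (fun z : R => - kappa * z^-1) (- kappa * - u ^- 2).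
    exact: (is_deriveZ (- kappa) Di).
  have D2 := @is_derive1_comp _ expR _ _ _ _ (is_derive_expR _) Dk.
  apply: (is_derive_eq (is_deriveM D1 D2)).
  by rewrite /flat_step !hornerE /= /GRing.scale/=; field.
- have [C C0 Cp] := flat_bounded (p * 'X * 'X).
  have lim : h^-1 *: ((flat p \o shift 0) (h *: (1:R)) - flat p 0) @[h --> 0^'] --> (0:R).
    have Ch : C * `|h| @[h --> (0:R)^'] --> (0:R).
      rewrite -[X in _ --> X](mulr0 C); apply: cvgMr.
      apply: cvg_within_filter.
      by have := @norm_continuous R R 0; rewrite /continuous_at normr0.
    apply/cvgr0Pnorm_le => e e0.
    have Che : \forall h \near (0 : R)^', `|C * `|h| | <= e.
      by move: e e0; apply/cvgr0Pnorm_le; exact: Ch.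
    near=> h.
    have : `|C * `|h| | <= e by near: h.
    have h0 : h != 0 by near: h; exact: nbhs_dnbhs_neq.
    rewrite normrM normr_id ger0_norm//; apply: le_trans.
    rewrite /= addr0 /GRing.scale/= mulr1 {2}/flat ltxx subr0.
    by rewrite -flat_mulX -flat_mulX mulKf// normrM mulrC ler_wpM2r.
  rewrite {2}/flat ltxx; apply: DeriveDef.
    by apply/cvg_ex; exists 0.
  exact/cvg_lim.
Unshelve. all: by end_near.
Qed.

Lemma flat_continuous (p : {poly R}) : continuous (flat p).
Proof.
move=> u; apply/differentiable_continuous/derivable1_diffP.
by case: (is_derive_flat p u).
Qed.

Lemma Ck_flat (V : normedModType R) n (p : {poly R}) (f : V -> R^o) :
  Ck n f -> Ck n (fun x => flat p (f x) : R^o).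
Proof.
pose H k := flat (iter k flat_step p).
apply: (@Ck_comp _ _ n setT H f 0) => // k s _; last exact: is_derive_flat.
exact: flat_continuous.
Qed.

(** A smooth substitute for the positive part. Its slope stays in [[0, 1]]
    because [(1 + s) * exp (- s) <= 1]. *)
Definition ramp (u : R) : R := u * flat 1 u.

Definition dramp (u : R) : R := u * flat (flat_step 1) u + flat 1 u.

Lemma Ck_ramp (V : normedModType R) n (f : V -> R^o) :
  Ck n f -> Ck n (fun x => ramp (f x) : R^o).
Proof. by move=> Cf; apply: CkM => //; exact: Ck_flat. Qed.

Lemma is_derive_ramp (u : R) : is_derive u (1 : R) ramp (dramp u).
Proof.
apply: (is_derive_eq (is_deriveM (is_derive_id u 1) (is_derive_flat 1 u))).
by rewrite /dramp /GRing.scale/= mulr1.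
Qed.

Lemma ramp_gt0E u : 0 < u -> ramp u = u * expR (- kappa / u).
Proof. by move=> u0; rewrite /ramp /flat u0 hornerC mul1r. Qed.

Lemma dramp_gt0E u : 0 < u -> dramp u = (1 + kappa / u) * expR (- kappa / u).
Proof.
move=> u0; rewrite /dramp /flat u0 /flat_step !hornerE /= derivC hornerC.
by rewrite ?hornerE; field; rewrite gt_eqF.
Qed.

Lemma ramp_le0 u : u <= 0 -> ramp u = 0.
Proof. by move=> u0; rewrite /ramp /flat ifN ?mulr0// -leNgt. Qed.

Lemma dramp_le0 u : u <= 0 -> dramp u = 0.
Proof. by move=> u0; rewrite /dramp /flat ltNge u0 /= mulr0 addr0. Qed.

Lemma dramp_bounds u : 0 <= dramp u <= 1.
Proof.
have [u0|u0] := leP u 0; first by rewrite dramp_le0// lexx ler01.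
rewrite dramp_gt0E//; have k0 : 0 <= kappa / u by rewrite divr_ge0 ?ltW.
rewrite mulr_ge0 ?expR_ge0 ?addr_ge0//= mulNr expRN.
by rewrite ler_pdivrMr ?expR_gt0// mul1r expR_ge1Dx.
Qed.

Lemma ramp_ge0 u : 0 <= ramp u.
Proof.
have [u0|u0] := leP u 0; first by rewrite ramp_le0.
by rewrite ramp_gt0E// mulr_ge0 ?expR_ge0 ?ltW.
Qed.

Lemma ramp_ge u : u - kappa <= ramp u.
Proof.
have [u0|u0] := leP u 0; first by rewrite ramp_le0// subr_le0 (le_trans u0) ?ltW.
rewrite ramp_gt0E//; have := expR_ge1Dx (- kappa / u).
rewrite -(ler_pM2l u0) => /(le_trans _); apply.
by rewrite le_eqVlt; apply/orP; left; apply/eqP; field; rewrite gt_eqF.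
Qed.

Lemma ramp_le u c : 0 <= c -> u <= c -> ramp u <= c.
Proof.
move=> c0 uc; have [u0|u0] := leP u 0; first by rewrite ramp_le0.
rewrite ramp_gt0E// (le_trans _ uc)// ger_pMr// -expR0 ler_expR.
by rewrite mulNr oppr_le0 divr_ge0 ?ltW.
Qed.

Lemma dramp_ge (l u : R) : 0 < l -> l <= u -> expR (- kappa / l) <= dramp u.
Proof.
move=> l0 lu; have u0 : 0 < u by exact: lt_le_trans lu.
rewrite dramp_gt0E// (@le_trans _ _ (expR (- kappa / u)))//.
  by rewrite ler_expR !mulNr lerN2 ler_pM2l// lef_pV2.
by rewrite ler_peMl ?expR_ge0// lerDl divr_ge0 ?ltW.
Qed.

End flat.

(** * Coordinates of space-time *)

Section coordinates.
Context {R : realType} {d : nat}.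
Notation V := ('rV[R]_d * R)%type.

Lemma is_derive_lin (U : normedModType R) (f : U -> R^o) (x v : U) :
  (forall (h : R) v x, f (h *: v + x) = h * f v + f x) -> is_derive x v f (f v).
Proof.
move=> fl; apply/is_derive_line.
have -> : (fun h : R => f (h *: v + x)) = (fun h => h * f v + f x).
  by apply/funext => h; rewrite fl.
have D := is_deriveD (is_deriveM (is_derive_id (0 : R) 1)
  (is_derive_cst (f v) (0 : R) 1)) (is_derive_cst (f x) (0 : R) 1).
by apply: (is_derive_eq D); rewrite /GRing.scale/= mulr0 mulr1 add0r addr0.
Qed.

Lemma Ck_lin (U : normedModType R) n (f : U -> R^o) :
  (forall (h : R) v x, f (h *: v + x) = h * f v + f x) -> continuous f ->
  Ck n f.
Proof.
move=> fl cf; case: n => [|n]; first by split.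
apply: (@CkS _ _ _ _ (fun v _ => f v)) => //; last by move=> v; exact: Ck_cst.
by move=> x v; exact: is_derive_lin.
Qed.

Lemma space_coord_lin i (h : R) (v x : V) :
  (h *: v + x).1 ord0 i = h * v.1 ord0 i + x.1 ord0 i.
Proof. by rewrite /= !mxE. Qed.

Lemma space_coord_continuous i : continuous (fun z : V => z.1 ord0 i : R).
Proof.
move=> z; apply: (@continuous_comp _ _ _ fst (fun M : 'rV[R]_d => M ord0 i)).
  exact: cvg_fst.
exact: coord_continuous.
Qed.

Lemma Ck_space_coord n i : Ck n (fun z : V => z.1 ord0 i : R^o).
Proof.
by apply: Ck_lin; [exact: space_coord_lin|exact: space_coord_continuous].
Qed.

Lemma Ck_time n : Ck n (fun z : V => z.2 : R^o).
Proof.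
by apply: Ck_lin => // z; exact: cvg_snd.
Qed.

Lemma is_derive_space_coord i (z v : V) :
  is_derive z v (fun z : V => z.1 ord0 i : R^o) (v.1 ord0 i).
Proof. exact: (is_derive_lin _ _ (space_coord_lin i)). Qed.

Lemma is_derive_time (z v : V) : is_derive z v (fun z : V => z.2 : R^o) v.2.
Proof. exact: (@is_derive_lin _ (fun z : V => z.2)). Qed.

Lemma compact_box (r : R) :
  compact [set z : V | (forall i, `|z.1 ord0 i| <= r) /\ `|z.2| <= r].
Proof.
have cI : compact `[- r, r]%classic by exact: segment_compact.
have := compact_setX (@rV_compact _ d (fun=> `[- r, r]%classic) (fun=> cI)) cI.
congr compact; apply/seteqP; split => -[x t]/=.
  move=> [xr tr]; split => [i|]; rewrite ler_norml.
    by have := xr i; rewrite in_itv.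
  by move: tr; rewrite in_itv.
move=> [xr tr]; split => [i|]; rewrite in_itv/= -ler_norml//.
Qed.

End coordinates.

(** * Subsolutions of the Hamilton-Jacobi equation *)

Section Ck_elementary.
Context {R : realType} {V : normedModType R}.
Implicit Type f : V -> R^o.

Lemma is_derive_continuous (h dh : R -> R) (s : R) :
  is_derive s (1 : R) h (dh s) -> {for s, continuous h}.
Proof. by case=> D _; exact/differentiable_continuous/derivable1_diffP. Qed.

Lemma Ck_expR n f : Ck n f -> Ck n (fun x => expR (f x) : R^o).
Proof.
apply: (@Ck_comp _ _ n setT (fun=> @expR R) f 0%N) => // k s _.
exact: continuous_expR.
Qed.

Definition inv_derive (k : nat) (s : R) : R := (-1) ^+ k * k`!%:R * s ^- k.+1.

Lemma is_derive_inv (s : R) : s != 0 ->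
  is_derive s (1 : R) (fun z : R => z^-1) (- s ^- 2).
Proof.
move=> s0; apply: (is_derive_eq (is_deriveV s0 (is_derive_id s 1))).
exact: mulr1.
Qed.

Lemma is_derive_inv_derive k (s : R) : 0 < s ->
  is_derive s (1 : R) (inv_derive k) (inv_derive k.+1 s).
Proof.
move=> s0; have sk0 : s ^+ k.+1 != 0 by rewrite expf_neq0// gt_eqF.
have D1 : is_derive s (1 : R) (fun z : R => z ^+ k.+1) (k.+1%:R * s ^+ k).
  apply: DeriveDef; first exact: exprn_derivable.
  by rewrite exp_derive /GRing.scale/= mulr1.
have D := is_deriveZ ((-1) ^+ k * k`!%:R)
  (is_deriveV (f := fun z : R => z ^+ k.+1) sk0 D1).
apply: (is_derive_eq D).
rewrite /inv_derive /GRing.scale/= factS natrM !exprS -!natr1.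
by field; rewrite expf_neq0 ?gt_eqF.
Qed.

Lemma Ck_inv n f : (forall x, 0 < f x) -> Ck n f ->
  Ck n (fun x => (f x)^-1 : R^o).
Proof.
move=> f0 Cf.
have -> : (fun x => (f x)^-1) = (fun x => inv_derive 0 (f x)).
  by apply/funext => x; rewrite /inv_derive !mul1r expr1.
apply: (@Ck_comp _ _ n [set s | 0 < s] inv_derive) => // k s s0.
  exact/is_derive_continuous/is_derive_inv_derive.
exact: is_derive_inv_derive.
Qed.

Lemma Ck_ln n f : (forall x, 0 < f x) -> Ck n f ->
  Ck n (fun x => ln (f x) : R^o).
Proof.
move=> f0 Cf.
pose H k : R -> R := if k is k'.+1 then inv_derive k' else @ln R.
have DH k (s : R) : 0 < s -> is_derive s (1 : R) (H k) (H k.+1 s).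
  move=> s0; case: k => [|k]; last exact: is_derive_inv_derive.
  by rewrite /H /inv_derive !mul1r expr1; exact: is_derive1_ln.
apply: (@Ck_comp _ _ n [set s | 0 < s] H f 0%N) => // k s s0.
  exact/is_derive_continuous/DH.
Qed.

End Ck_elementary.

Lemma is_derive_big (R : realType) (V : normedModType R) (I : Type)
    (s : seq I) (F : I -> V -> R^o) (dF : I -> R) (x v : V) :
  (forall i, is_derive x v (F i) (dF i)) ->
  is_derive x v (fun y => \sum_(i <- s) F i y : R^o) (\sum_(i <- s) dF i).
Proof.
move=> DF; elim: s => [|i s IH].
  have -> : (fun y => \sum_(i <- [::]) F i y) = (cst 0 : V -> R^o).
    by apply/funext => y; rewrite big_nil.
  by rewrite big_nil; exact: is_derive_cst.
have -> : (fun y => \sum_(j <- i :: s) F j y) =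
    (fun y => F i y + \sum_(j <- s) F j y).
  by apply/funext => y; rewrite big_cons.
by rewrite big_cons; exact: (is_deriveD (DF i) IH).
Qed.

(** The nonnegativity of the variance. *)
Lemma convex_sqr (R : realFieldType) (I : finType) (w v : I -> R) :
  (forall i, 0 <= w i) -> \sum_i w i = 1 ->
  (\sum_i w i * v i) ^+ 2 <= \sum_i w i * v i ^+ 2.
Proof.
move=> w0 w1; set m := \sum_i w i * v i.
have : 0 <= \sum_i w i * (v i - m) ^+ 2.
  by apply: sumr_ge0 => i _; rewrite mulr_ge0// sqr_ge0.
rewrite (eq_bigr (fun i =>
    w i * v i ^+ 2 + (- 2 * m) * (w i * v i) + m ^+ 2 * w i)); last first.
  by move=> i _; ring.
by rewrite !big_split/= -!mulr_sumr w1 -/m; lra.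
Qed.

(** The Hopf-Lax formula solves the Hamilton-Jacobi equation
    [d_t f + |grad f|^2 / 2 = 0] by the minimum over [i] of the branches
    [phi i + |y - x i|^2 / (2 t)]. Three modifications make it a smooth
    subsolution with compact support. The minimum becomes a soft minimum
    [- sigma ln (\sum_i expR (- branch i / sigma))]: its derivative is a convex
    combination of those of the branches, and the squared gradient is convex.
    Composition with [- ramp (- _)], whose slope lies in [[0, 1]], keeps the
    inequality and annihilates the function where all branches are positive
    enough. The time is replaced by [tau], and a barrier is added outside
    [[0, 1]]. *)
Section hj.
Context {R : realType} {d : nat} {I : finType} (i0 : I).
Context (x : I -> 'rV[R]_d) (phi : I -> R) (delta eps : R).
Hypotheses (delta0 : 0 < delta) (eps0 : 0 < eps).
Notation V := ('rV[R]_d * R)%type.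

(** Positive for all [t], and of slope at least [1] on [[0, 1]], which is what a
    branch [phi i + |y - x i|^2 / (2 tau)] needs to be a subsolution there: the
    slope of the ramp is at least [expR (- delta)] beyond [delta]. *)
Let tau (t : R) : R := delta + expR delta * ramp (delta ^+ 2) (t + delta).
Let dtau (t : R) : R := expR delta * dramp (delta ^+ 2) (t + delta).
Let barrier (t : R) : R := ramp 1 (- t) + ramp 1 (t - 1).
Let dbarrier (t : R) : R := - dramp 1 (- t) + dramp 1 (t - 1).

Let branch (i : I) (z : V) : R :=
  phi i + sqnorm (z.1 - x i) / 2 / tau z.2 + barrier z.2.
Let sigma : R := eps / (1 + ln #|I|%:R).
Let S (z : V) : R := \sum_i expR (- sigma^-1 * branch i z).
Let zeta (z : V) : R := - ramp eps (sigma * ln (S z)).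

Let lnI0 : 0 <= ln #|I|%:R :> R.
Proof. by rewrite ln_ge0// ler1n; apply/card_gt0P; exists i0. Qed.

Let sigma0 : 0 < sigma.
Proof. by rewrite divr_gt0// ltr_pwDl. Qed.

Let sigma_ln : sigma * ln #|I|%:R <= eps.
Proof.
by rewrite /sigma mulrAC ler_pdivrMr ?ltr_pwDl// mulrDr mulr1 lerDr ltW.
Qed.

Let tau0 t : 0 < tau t.
Proof. by rewrite ltr_pwDl// mulr_ge0 ?expR_ge0 ?ramp_ge0// exprn_gt0. Qed.

Let S0 z : 0 < S z.
Proof.
rewrite /S (bigD1 i0)//= ltr_pwDl ?expR_gt0//.
by apply: sumr_ge0 => i _; exact: expR_ge0.
Qed.

Let Ck_shift n c : Ck n (fun z : V => z.2 + c : R^o).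
Proof. by apply: CkD; [exact: Ck_time|exact: Ck_cst]. Qed.

Let Ck_branch n i : Ck n (branch i : V -> R^o).
Proof.
have d2 : 0 < delta ^+ 2 by rewrite exprn_gt0.
do 2![apply: CkD]; first exact: Ck_cst.
- apply: CkM.
    apply: CkM; last exact: Ck_cst.
    apply: Ck_sum => k.
    have C : Ck n (fun z : V => (z.1 - x i) ord0 k : R^o).
      have -> : (fun z : V => (z.1 - x i) ord0 k) =
          (fun z : V => z.1 ord0 k + (- x i ord0 k)).
        by apply/funext => z; rewrite !mxE.
      by apply: CkD; [exact: Ck_space_coord|exact: Ck_cst].
    exact: CkM.
  apply: Ck_inv; first by move=> z; exact: tau0.
  apply: (@CkD _ _ _ (fun=> delta)
    (fun z : V => expR delta * ramp (delta ^+ 2) (z.2 + delta))).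
    exact: Ck_cst.
  apply: CkM; first exact: Ck_cst.
  exact: Ck_ramp.
- apply: Ck_ramp => //.
  have -> : (fun z : V => - z.2) = (fun z : V => -1 * z.2).
    by apply/funext => z; rewrite mulN1r.
  by apply: CkM; [exact: Ck_cst|exact: Ck_time].
- exact: Ck_ramp.
Qed.

Let Ck_S n : Ck n (S : V -> R^o).
Proof.
apply: Ck_sum => i; apply: Ck_expR; apply: CkM; first exact: Ck_cst.
exact: Ck_branch.
Qed.

Let zeta_smooth : smooth (W := R^o) zeta.
Proof.
apply: smooth_Ck => n.
have -> : zeta = (fun z : V => -1 * ramp eps (sigma * ln (S z))).
  by apply/funext => z; rewrite mulN1r.
apply: CkM; first exact: Ck_cst.
apply: Ck_ramp => //; apply: CkM; first exact: Ck_cst.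
by apply: Ck_ln; [exact: S0|exact: Ck_S].
Qed.

Let is_derive_tau (t : R) : is_derive t (1 : R) tau (dtau t).
Proof.
have d2 : 0 < delta ^+ 2 by rewrite exprn_gt0.
have Dt : is_derive t (1 : R) (fun t : R => t + delta) 1.
  apply: (is_derive_eq (is_deriveD (is_derive_id t (1 : R))
    (is_derive_cst delta t (1 : R)))).
  by rewrite addr0.
have D1 := @is_derive1_comp _ (ramp (delta ^+ 2)) (fun t => t + delta) t _ _
  (is_derive_ramp d2 (t + delta)) Dt.
apply: (is_derive_eq (is_deriveD (is_derive_cst delta t (1 : R))
  (is_deriveZ (expR delta) D1))).
by rewrite add0r mulr1.
Qed.

Let is_derive_barrier (t : R) : is_derive t (1 : R) barrier (dbarrier t).
Proof.
have Dn : is_derive t (1 : R) (fun t : R => - t) (- 1).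
  exact: (is_deriveN (is_derive_id t (1 : R))).
have Ds : is_derive t (1 : R) (fun t : R => t - 1) 1.
  apply: (is_derive_eq (is_deriveB (is_derive_id t (1 : R))
    (is_derive_cst (1 : R) t (1 : R)))).
  by rewrite subr0.
have D1 := @is_derive1_comp _ (ramp 1) (fun t => - t) t _ _
  (is_derive_ramp ltr01 (- t)) Dn.
have D2 := @is_derive1_comp _ (ramp 1) (fun t => t - 1) t _ _
  (is_derive_ramp ltr01 (t - 1)) Ds.
apply: (is_derive_eq (is_deriveD D1 D2)).
by rewrite mulr1 mulrN1.
Qed.

Let dbranch (i : I) (z v : V) : R :=
  dotv (z.1 - x i) v.1 / tau z.2 -
  sqnorm (z.1 - x i) / 2 * dtau z.2 / tau z.2 ^+ 2 * v.2 +
  dbarrier z.2 * v.2.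

Let is_derive_sqnorm i (z v : V) :
  is_derive z v (fun z : V => sqnorm (z.1 - x i)) (2 * dotv (z.1 - x i) v.1).
Proof.
have Dk k : is_derive z v (fun z : V => z.1 ord0 k - x i ord0 k : R^o) (v.1 ord0 k).
  apply: (is_derive_eq (is_deriveB (is_derive_space_coord k z v)
    (is_derive_cst (x i ord0 k : R^o) z v))).
  by rewrite subr0.
have D := is_derive_big (index_enum 'I_d) (fun k => is_deriveM (Dk k) (Dk k)).
have E : (fun z : V => sqnorm (z.1 - x i)) = (fun z : V => \sum_(k < d)
    (z.1 ord0 k - x i ord0 k) * (z.1 ord0 k - x i ord0 k)).
  by apply/funext => y; apply: eq_bigr => k _; rewrite !mxE.
rewrite E; apply: (is_derive_eq D); rewrite /dotv mulr_sumr.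
by apply: eq_bigr => k _; rewrite /GRing.scale/= !mxE; ring.
Qed.

Let is_derive_branch i (z v : V) : is_derive z v (branch i) (dbranch i z v).
Proof.
have taun : tau z.2 != 0 by rewrite gt_eqF.
have Dtau := is_derive_comp_line (is_derive_time z v) (is_derive_tau z.2).
have Dinv := is_derive_comp_line Dtau (is_derive_inv taun).
have Dbar := is_derive_comp_line (is_derive_time z v) (is_derive_barrier z.2).
have Dsq := is_deriveM (is_derive_sqnorm i z v) (is_derive_cst (2^-1 : R) z v).
have D := is_deriveD (is_deriveD (is_derive_cst (phi i : R) z v)
  (is_deriveM Dsq Dinv)) Dbar.
apply: (is_derive_eq D).
by rewrite /dbranch /GRing.scale/= /GRing.scale/= !fctE; field.
Qed.

Let w (z : V) i : R := expR (- sigma^-1 * branch i z) / S z.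

Let w_ge0 z i : 0 <= w z i.
Proof. by rewrite divr_ge0 ?expR_ge0 ?ltW. Qed.

Let sum_w z : \sum_i w z i = 1.
Proof. by rewrite /w -mulr_suml -/(S z) divff// gt_eqF. Qed.

Let slope (z : V) : R := dramp eps (sigma * ln (S z)).

Let is_derive_zeta (z v : V) :
  is_derive z v zeta (slope z * \sum_i w z i * dbranch i z v).
Proof.
have DE i : is_derive z v (fun z => expR (- sigma^-1 * branch i z))
    (expR (- sigma^-1 * branch i z) * (- sigma^-1 * dbranch i z v)).
  apply: (is_derive_comp_line (f := fun z => - sigma^-1 * branch i z)).
  exact: (is_deriveZ (- sigma^-1) (is_derive_branch i z v)).
have DS : is_derive z v S
    (\sum_i expR (- sigma^-1 * branch i z) * (- sigma^-1 * dbranch i z v)).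
  exact: is_derive_big.
have Dln := is_derive_comp_line DS (is_derive1_ln (S0 z)).
have Dsln : is_derive z v (fun z => sigma * ln (S z)) _ := is_deriveZ sigma Dln.
have D := is_deriveN (is_derive_comp_line Dsln (is_derive_ramp eps0 _)).
apply: (is_derive_eq D); rewrite -/(slope z) -mulrN; congr (_ * _).
rewrite /GRing.scale/= !mulr_sumr -sumrN; apply: eq_bigr => i _; rewrite /w.
by field; rewrite !gt_eqF.
Qed.

Let dbarrier0 t : 0 <= t <= 1 -> dbarrier t = 0.
Proof.
move=> /andP[t0 t1].
by rewrite /dbarrier !dramp_le0 ?oppr0 ?addr0// ?subr_le0// oppr_le0.
Qed.

Let barrier0 t : 0 <= t <= 1 -> barrier t = 0.
Proof.
move=> /andP[t0 t1].
by rewrite /barrier !ramp_le0 ?oppr0 ?addr0// ?subr_le0// oppr_le0.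
Qed.

Let dtau_ge1 t : 0 <= t -> 1 <= dtau t.
Proof.
move=> t0; have d2 : 0 < delta ^+ 2 by rewrite exprn_gt0.
have := @dramp_ge _ _ d2 delta (t + delta) delta0.
rewrite lerDr => /(_ t0) h; apply: le_trans (ler_wpM2l (expR_ge0 delta) h).
by rewrite -expRD expr2 mulNr mulfK ?gt_eqF// subrr expR0.
Qed.

Let zeta_subsolution z : strip z ->
  time_derivative zeta z + sqnorm (space_gradient zeta z) / 2 <= 0.
Proof.
move=> [_ /=]; rewrite in_itv/= => t01; have /andP[t0 t1] := t01.
have -> : time_derivative zeta z = slope z * \sum_i w z i *
    (- (sqnorm (z.1 - x i) / 2 * dtau z.2 / tau z.2 ^+ 2)).
  rewrite /time_derivative.
  rewrite (@derive_val _ _ _ _ _ _ _ (is_derive_zeta z (0, 1))).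
  congr (_ * _); apply: eq_bigr => i _; congr (_ * _).
  rewrite /dbranch/= dbarrier0// mul0r addr0 mulr1.
  by rewrite /dotv big1 ?mul0r ?sub0r// => k _; rewrite !mxE mulr0.
have grad k : space_gradient zeta z ord0 k =
    slope z * \sum_i w z i * ((z.1 - x i) ord0 k / tau z.2).
  rewrite /space_gradient mxE.
  rewrite (@derive_val _ _ _ _ _ _ _ (is_derive_zeta z (delta_mx ord0 k, 0))).
  congr (_ * _); apply: eq_bigr => i _; congr (_ * _).
  rewrite /dbranch/= !mulr0 subr0 addr0 /dotv (bigD1 k)//= big1; last first.
    by move=> l lk; rewrite !mxE eqxx (negPf lk) mulr0.
  by rewrite addr0 [X in _ * X / _]mxE !eqxx mulr1.
have /andP[s0 s1] : 0 <= slope z <= 1 by exact: dramp_bounds.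
have sq : sqnorm (space_gradient zeta z) <=
    slope z * \sum_i w z i * (sqnorm (z.1 - x i) / tau z.2 ^+ 2).
  rewrite (@le_trans _ _ (slope z * \sum_k (\sum_i w z i *
      ((z.1 - x i) ord0 k / tau z.2)) ^+ 2))//.
    rewrite /sqnorm /dotv mulr_sumr ler_sum// => k _; rewrite grad.
    rewrite mulrACA -expr2 ler_wpM2r ?sqr_ge0//.
    by rewrite ler_piMl.
  rewrite ler_wpM2l//.
  under [leRHS]eq_bigr do rewrite /sqnorm /dotv mulr_suml mulr_sumr.
  rewrite exchange_big/= ler_sum// => k _.
  (* Jensen's inequality in each coordinate of the gradient. *)
  apply: le_trans (convex_sqr _ (w_ge0 z) (sum_w z)) _.
  by rewrite le_eqVlt; apply/orP; left; apply/eqP; apply: eq_bigr => i _;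
    rewrite -expr2 expr_div_n.
rewrite -lerBrDr sub0r (@le_trans _ _ (- (slope z * \sum_i w z i *
   (sqnorm (z.1 - x i) / tau z.2 ^+ 2)) / 2))//; last first.
  by rewrite mulNr lerN2 ler_wpM2r// invr_ge0.
rewrite mulNr lerNr -mulrN -sumrN -mulrA ler_wpM2l// mulr_suml ler_sum// => i _.
have sq0 : 0 <= sqnorm (z.1 - x i) by apply: sumr_ge0 => k _; exact: sqr_ge0.
rewrite mulrN opprK -[leLHS]mulrA ler_wpM2l// mulrAC ler_wpM2r//.
  by rewrite invr_ge0 exprn_ge0// ltW.
by rewrite ler_peMr ?dtau_ge1// divr_ge0.
Qed.

Let zeta_le0 z : zeta z <= 0.
Proof. by rewrite oppr_le0 ramp_ge0. Qed.

Let zeta_initial y i : zeta (y, 0) <= phi i + sqnorm (y - x i) / (2 * delta) + eps.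
Proof.
have sq0 : 0 <= sqnorm (y - x i) by apply: sumr_ge0 => k _; exact: sqr_ge0.
have d0 : 0 < delta ^+ 2 by rewrite exprn_gt0.
have branch0 : branch i (y, 0) <= phi i + sqnorm (y - x i) / (2 * delta).
  rewrite /branch/= barrier0 ?lexx ?ler01// addr0 lerD2l invfM mulrA.
  rewrite ler_wpM2l ?divr_ge0// lef_pV2 ?posrE//.
  by rewrite /tau lerDl mulr_ge0 ?expR_ge0 ?ramp_ge0.
have lnS : - sigma^-1 * branch i (y, 0) <= ln (S (y, 0)).
  rewrite -[leLHS]expRK ler_ln ?posrE ?expR_gt0// /S (bigD1 i)//= lerDl.
  by apply: sumr_ge0 => k _; exact: expR_ge0.
have u_ge : - branch i (y, 0) <= sigma * ln (S (y, 0)).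
  rewrite -(ler_pM2l sigma0) in lnS; apply: le_trans lnS.
  by rewrite mulrA mulrN divff ?mulN1r// gt_eqF.
have := ramp_ge eps0 (sigma * ln (S (y, 0))).
by rewrite /zeta; lra.
Qed.

Let zeta_final y c : c <= 0 ->
  (forall i, c <= phi i +
     sqnorm (y - x i) / (2 * (delta + expR delta * (1 + delta)))) ->
  c - eps <= zeta (y, 1).
Proof.
move=> c0 cle; rewrite /zeta lerNr opprB; apply: ramp_le => //.
  by rewrite subr_ge0 (le_trans c0)// ltW.
have branchc i : c <= branch i (y, 1).
  have sq0 : 0 <= sqnorm (y - x i) by apply: sumr_ge0 => k _; exact: sqr_ge0.
  apply: le_trans (cle i) _.
  rewrite /branch/= barrier0 ?lexx ?ler01// addr0 lerD2l invfM mulrA.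
  rewrite ler_wpM2l ?divr_ge0// lef_pV2 ?posrE//.
    rewrite /tau lerD2l ler_wpM2l ?expR_ge0//.
    by rewrite ramp_le// ?exprn_gt0// addr_ge0 ?ltW.
  by rewrite addr_gt0// mulr_gt0 ?expR_gt0// addr_gt0.
have SE : S (y, 1) <= #|I|%:R * expR (- sigma^-1 * c).
  rewrite mulr_natl -sumr_const ler_sum// => i _.
  by rewrite ler_expR !mulNr lerN2 ler_pM2l ?invr_gt0.
have I0 : (0 : R) < #|I|%:R by rewrite ltr0n; apply/card_gt0P; exists i0.
have : ln (S (y, 1)) <= ln #|I|%:R - sigma^-1 * c.
  rewrite -(expRK (- (sigma^-1 * c))) -mulNr -lnM ?posrE ?expR_gt0//.
  by rewrite ler_ln ?posrE// mulr_gt0 ?expR_gt0.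
rewrite -(ler_pM2l sigma0) mulrBr mulVKf ?gt_eqF// => /le_trans; apply.
by rewrite lerD2r.
Qed.

Let zeta_supported : exists r : R, forall z : V,
  ~ ((forall k, `|z.1 ord0 k| <= r) /\ `|z.2| <= r) -> zeta z = 0.
Proof.
(* A branch exceeds eps once its barrier or its quadratic term exceeds M. At
   times where the barrier does not, tau is at most A, so that a distance of
   2 A M + 1 from the centers is enough for the quadratic term. *)
pose M := `|eps| + \sum_i `|phi i|.
have M0 : 0 <= M by rewrite addr_ge0// sumr_ge0.
pose A := delta + expR delta * (M + 2 + delta).
have A0 : 0 < A by rewrite addr_gt0// mulr_gt0 ?expR_gt0//; move: delta0; lra.
pose X := \sum_i \sum_k `|x i ord0 k|.
have X0 : 0 <= X by apply: sumr_ge0 => i _; apply: sumr_ge0.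
have AM0 : 0 <= A * M by rewrite mulr_ge0// ltW.
exists (M + 2 + X + (2 * (A * M) + 1)) => z zr.
suff big i : eps <= branch i z.
  have SE : S z <= #|I|%:R * expR (- sigma^-1 * eps).
    rewrite mulr_natl -sumr_const ler_sum// => i _.
    by rewrite ler_expR !mulNr lerN2 ler_pM2l ?invr_gt0.
  have I0 : (0 : R) < #|I|%:R by rewrite ltr0n; apply/card_gt0P; exists i0.
  have : ln (S z) <= ln #|I|%:R - sigma^-1 * eps.
    rewrite -(expRK (- (sigma^-1 * eps))) -mulNr -lnM ?posrE ?expR_gt0//.
    by rewrite ler_ln ?posrE// mulr_gt0 ?expR_gt0.
  rewrite -(ler_pM2l sigma0) mulrBr mulVKf ?gt_eqF// => lnS.
  by rewrite /zeta ramp_le0 ?oppr0// (le_trans lnS)// subr_le0.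
have phiM : eps <= phi i + M.
  have : `|phi i| <= \sum_i `|phi i|.
    by rewrite (bigD1 i)//= lerDl sumr_ge0.
  have := ler_norm eps; have := ler_norm (- phi i); rewrite normrN /M; lra.
rewrite (le_trans phiM)// /branch -addrA lerD2l.
have sq0 : 0 <= sqnorm (z.1 - x i) by apply: sumr_ge0 => k _; exact: sqr_ge0.
have sqtau0 : 0 <= sqnorm (z.1 - x i) / 2 / tau z.2.
  by rewrite divr_ge0 ?divr_ge0// ltW.
have r1 := @ramp_ge0 _ 1 (- z.2); have r2 := @ramp_ge0 _ 1 (z.2 - 1).
have r3 := ramp_ge (ltr01 : (0 : R) < 1) (- z.2).
have r4 := ramp_ge (ltr01 : (0 : R) < 1) (z.2 - 1).
rewrite /barrier.
have [zM|Mz] := leP (M + 2) `|z.2|.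
  have [z0|z0] := leP 0 z.2.
    by move: zM; rewrite ger0_norm//; lra.
  by move: zM; rewrite ltr0_norm//; lra.
have [k zk] : exists k, M + 2 + X + (2 * (A * M) + 1) < `|z.1 ord0 k|.
  apply/existsP; rewrite -[X in is_true X]negbK; apply/negP => /existsPn nk.
  apply: zr; split => [k|]; last by lra.
  by rewrite leNgt nk.
have tauA : tau z.2 <= A.
  rewrite /tau lerD2l ler_wpM2l ?expR_ge0// ramp_le ?exprn_gt0//.
    by move: delta0; lra.
  by have := ler_norm z.2; lra.
suff : M <= sqnorm (z.1 - x i) / 2 / tau z.2 by lra.
rewrite ler_pdivlMr// ler_pdivlMr// (@le_trans _ _ (2 * (A * M)))//.
  by rewrite mulrC ler_wpM2l// mulrC ler_wpM2r.
have diff : 2 * (A * M) + 1 <= `|(z.1 - x i) ord0 k|.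
  have xk : `|x i ord0 k| <= X.
    rewrite /X (bigD1 i)//= (bigD1 k)//= -addrA lerDl.
    by rewrite addr_ge0// ?sumr_ge0// => j _; rewrite sumr_ge0.
  have := lerB_dist (z.1 ord0 k) (x i ord0 k).
  by rewrite !mxE; lra.
rewrite (@le_trans _ _ (`|(z.1 - x i) ord0 k| ^+ 2))//; first by nra.
rewrite real_normK ?num_real// /sqnorm /dotv (bigD1 k)//= -expr2 lerDl.
by apply: sumr_ge0 => l _; exact: sqr_ge0.
Qed.

Lemma hamilton_jacobi_test_function : exists f : V -> R,
  [/\ Cc_smooth f,
      forall z, strip z ->
        time_derivative f z + sqnorm (space_gradient f z) / 2 <= 0,
      forall z, f z <= 0,
      forall y i, f (y, 0) <= phi i + sqnorm (y - x i) / (2 * delta) + eps &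
      forall y c, c <= 0 ->
        (forall i, c <= phi i +
           sqnorm (y - x i) / (2 * (delta + expR delta * (1 + delta)))) ->
        c - eps <= f (y, 1)].
Proof.
exists zeta; split => //; split; first exact: zeta_smooth.
split.
  apply: continuous_subspaceT => z.
  by have [cz _] := zeta_smooth [::]; exact: cz.
have [r rP] := zeta_supported.
exists [set z : V | (forall k, `|z.1 ord0 k| <= r) /\ `|z.2| <= r].
by split => //; [exact: compact_box|move=> z _ /rP].
Qed.
End hj.

(** * Measurability of continuous functions of several variables *)

Section borel.
Context {R : realType}.

Lemma measurable_coord (d : nat) (i : 'I_d) :
  measurable_fun setT (fun x : 'rV[R]_d => x ord0 i).
Proof.
apply: (measurability _ (RGenOpens.measurableE R)).
move=> _ [_ [a [b ->] <-]]; rewrite setTI.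
apply: sub_sigma_algebra; apply: open_comp => /=; last exact: interval_open.
by move=> x _; exact: coord_continuous.
Qed.

Lemma measurable_fun_countable d (T : measurableType d) d' (U : measurableType d')
    (C : countType) (q : T -> C) (g : C -> U) :
  (forall c, measurable [set w | q w = c]) -> measurable_fun setT (g \o q).
Proof.
move=> mq _ B mB; rewrite setTI.
have -> : (g \o q) @^-1` B =
    \bigcup_c (if `[< B (g c) >] then [set w | q w = c] else set0).
  apply/seteqP; split => [w Bw|w [c _]] /=.
    by exists (q w) => //; rewrite asboolT.
  by case: asboolP => /= [Bc qc|_ []]; rewrite qc.
apply: countable_bigcupT_measurable; first exact: countableP.
by move=> c; case: ifP.
Qed.

Definition grid (c : R) (d : nat) (x : 'rV[R]_d) : 'rV[int]_d :=
  \row_i Num.floor (x ord0 i * c).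

Lemma measurable_floor_fiber d (T : measurableType d) (s : T -> R) (c : R) k :
  measurable_fun setT s -> measurable [set w | Num.floor (s w * c) = k].
Proof.
move=> ms.
have -> : [set w | Num.floor (s w * c) = k] =
    setT `&` (fun w => s w * c) @^-1` `[k%:~R, (k + 1)%:~R[%classic.
  apply/seteqP; split=> w /=; rewrite in_itv/=.
    by move=> <-; split => //; exact: floor_itv.
  by move=> [_ ?]; exact: floor_def.
by apply: measurable_funM => //; exact: measurable_cst.
Qed.

Lemma measurable_grid_fiber d (T : measurableType d) (n : nat) (X : T -> 'rV[R]_n)
    (c : R) k :
  (forall i, measurable_fun setT (fun w => X w ord0 i)) ->
  measurable [set w | grid c (X w) = k].
Proof.
move=> mX.
have -> : [set w | grid c (X w) = k] =
    \bigcap_(i in [set: 'I_n]) [set w | Num.floor (X w ord0 i * c) = k ord0 i].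
  apply/seteqP; split => w /=.
    by move=> /rowP wk i _ /=; have := wk i; rewrite !mxE.
  by move=> wk; apply/rowP => i; rewrite mxE; exact: wk.
apply: fin_bigcap_measurable => // i _.
exact: (measurable_floor_fiber (s := fun w => X w ord0 i)).
Qed.

Definition grid_point (c : R) (d : nat) (k : 'rV[int]_d) : 'rV[R]_d :=
  \row_i ((k ord0 i)%:~R / c).

Lemma floor_div_dist (c t : R) : 0 < c ->
  `|(Num.floor (t * c))%:~R / c - t| <= c^-1.
Proof.
move=> c0; have /andP[f1 f2] := floor_itv (t * c).
rewrite intrD in f2.
have -> : (Num.floor (t * c))%:~R / c - t = ((Num.floor (t * c))%:~R - t * c) / c.
  by field; rewrite gt_eqF.
rewrite normrM (gtr0_norm (x := c^-1)) ?invr_gt0// ler_piMl ?invr_ge0 ?(ltW c0)//.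
by rewrite ler_norml; apply/andP; split; lra.
Qed.

Lemma rV_norm_le n (x : 'rV[R]_n) (e : R) : 0 <= e ->
  (forall i, `|x ord0 i| <= e) -> `|x| <= e.
Proof.
move=> e0 xe; rewrite /Num.norm/= mx_normrE bigmax_le// => -[i k] _ /=.
by rewrite (ord1 i).
Qed.

Lemma grid_point_dist (d : nat) (c : R) (x : 'rV[R]_d) i : 0 < c ->
  `|(grid_point c (grid c x) - x) ord0 i| <= c^-1.
Proof. by move=> c0; rewrite !mxE; exact: floor_div_dist. Qed.

(** A continuous function is the limit of its compositions with the projections
    onto finer and finer grids, which take countably many values. This needs
    only measurable coordinates, hence applies to every product sigma-algebra. *)
Lemma measurable_continuous_comp d (T : measurableType d) (n : nat)
    (f : 'rV[R]_n * R -> R) (X : T -> 'rV[R]_n) (s : T -> R) :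
  continuous f -> (forall i, measurable_fun setT (fun w => X w ord0 i)) ->
  measurable_fun setT s -> measurable_fun setT (fun w => f (X w, s w)).
Proof.
move=> cf mX ms.
pose h N (k : 'rV[int]_n * int) := f (grid_point N.+1%:R k.1, k.2%:~R / N.+1%:R).
pose q N w := (grid N.+1%:R (X w), Num.floor (s w * N.+1%:R)).
apply: (@measurable_fun_cvg _ _ _ setT (fun N => h N \o q N)) => [N|w _].
  apply: measurable_fun_countable => -[k l].
  rewrite (_ : [set w | q N w = (k, l)] = [set w | grid N.+1%:R (X w) = k] `&`
    [set w | Num.floor (s w * N.+1%:R) = l]).
    apply: measurableI; first exact: measurable_grid_fiber.
    exact: measurable_floor_fiber.
  by apply/seteqP; split => w /=; [case=> -> ->|case=> <- <-].
have q_cvg : (grid_point N.+1%:R (q N w).1, (q N w).2%:~R / N.+1%:R)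
    @[N --> \oo] --> (X w, s w).
  apply/cvgrPdist_le => e e0.
  have : \forall N \near \oo, (N.+1%:R : R)^-1 < e.
    exact: (near_infty_natSinv_lt (PosNum e0)).
  apply: filterS => N Ne.
  have N0 : (0 : R) < N.+1%:R by rewrite ltr0n.
  rewrite prod_normE ge_max; apply/andP; split; last first.
    by rewrite /= distrC (le_trans (floor_div_dist _ N0))// ltW.
  rewrite /= distrC rV_norm_le// ?ltW// => i.
  by rewrite ltW// (le_lt_trans (grid_point_dist _ _ N0)).
exact: (cvg_comp _ _ q_cvg (cf _)).
Qed.

End borel.

(** * Compactly supported functions on the strip *)

Section strip_functions.
Context {R : realType} {d : nat}.
Notation V := ('rV[R]_d * R)%type.

Definition box (r : R) : set V :=
  [set z : V | (forall i, `|z.1 ord0 i| <= r) /\ 0 <= z.2 <= 1].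

Lemma box_strip r : box r `<=` @strip R d.
Proof. by move=> z [_ z01]; split => //=; rewrite in_itv. Qed.

Lemma compact_box01 r : compact (box r).
Proof.
have cI (a b : R) : compact `[a, b]%classic by exact: segment_compact.
have := compact_setX (@rV_compact _ d (fun=> `[- r, r]%classic)
  (fun=> cI _ _)) (cI 0 1).
congr compact; apply/seteqP; split => -[x t]/=.
  by move=> [xr tr]; split => [i|//]; have := xr i; rewrite in_itv/= -ler_norml.
by move=> [xr tr]; split => [i|]; rewrite in_itv//= -ler_norml.
Qed.

Lemma measurable_strip : measurable (@strip R d).
Proof. by apply: measurableX => //; exact: measurable_itv. Qed.

Lemma measurable_space_coord i : measurable_fun setT (fun z : V => z.1 ord0 i).
Proof. exact: (measurableT_comp (measurable_coord i) measurable_fst). Qed.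

Lemma measurable_box r : measurable (box r).
Proof.
have -> : box r = \bigcap_(i in [set: 'I_d])
    ((fun z : V => z.1 ord0 i) @^-1` `[- r, r]%classic) `&` @strip R d.
  apply/seteqP; split => z /=.
    move=> [zr z01]; split => [i _ /=|]; last by split => //=; rewrite in_itv.
    by rewrite in_itv/= -ler_norml.
  move=> [zr [_ /=]]; rewrite in_itv/= => z01; split => // i.
  by have := zr i Logic.I; rewrite /= in_itv/= -ler_norml.
apply: measurableI; last exact: measurable_strip.
apply: fin_bigcap_measurable => // i _.
rewrite -[X in measurable X]setTI; apply: measurable_space_coord => //.
Qed.

Lemma continuous_measurable (f : V -> R) : continuous f ->
  measurable_fun setT f.
Proof.
move=> cf; have := measurable_continuous_comp cf measurable_space_coord measurable_snd.
by under eq_fun do rewrite -surjective_pairing.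
Qed.

Definition clamp (z : V) : V := (z.1, Num.max 0 (Num.min 1 z.2)).

Lemma clamp_strip z : strip (clamp z).
Proof.
split => //=; rewrite in_itv/= le_max lexx/= ge_max ler01/=.
by rewrite ge_min lexx.
Qed.

Lemma clamp_id z : strip z -> clamp z = z.
Proof.
move=> [_ /=]; rewrite in_itv/= => /andP[z0 z1].
by case: z z0 z1 => x t /= t0 t1; rewrite /clamp/= min_r// max_r.
Qed.

Lemma clamp_continuous : continuous clamp.
Proof.
move=> z.
apply: (@cvg_pair _ _ _ (nbhs z) (nbhs z.1) (nbhs (clamp z).2) _ _ _ fst
  (fun y => (clamp y).2)); first exact: cvg_fst.
apply: (@continuous_max _ _ (cst 0) (cst 1 \min (snd : V -> R^o))).
  exact: cst_continuous.
apply: continuous_min; first exact: cst_continuous.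
exact: cvg_snd.
Qed.

Lemma clamp_comp_continuous (W : topologicalType) (f : V -> W) :
  {within @strip R d, continuous f} -> continuous (f \o clamp).
Proof.
move=> cf z; move/subspace_continuousP : cf => /(_ _ (clamp_strip z)).
apply: (@cvg_comp _ _ _ clamp f _ (within (@strip R d) (nbhs (clamp z)))).
move=> A wA; have cA : nbhs z (clamp @^-1` (fun y => strip y -> A y)).
  exact: (clamp_continuous wA).
have : nbhs z (clamp @^-1` A) by apply: filterS cA => y; apply; exact: clamp_strip.
exact.
Qed.

Lemma compact_strip_box (K : set V) : compact K -> exists2 r, 0 <= r &
  K `<=` [set z : V | (forall i, `|z.1 ord0 i| <= r) /\ `|z.2| <= r].
Proof.
move=> /compact_bounded[M [_ HM]]; exists (`|M| + 1); first by rewrite addr_ge0.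
move=> z Kz; have := HM (`|M| + 1).
rewrite (le_lt_trans (ler_norm M)) ?ltrDl// => /(_ isT _ Kz) /=.
rewrite prod_normE ge_max => /andP[z1 z2]; split => // i.
rewrite (le_trans _ z1)// /Num.norm/= mx_normrE.
by apply: (le_bigmax _ (fun j => `|z.1 j.1 j.2|) (ord0, i)).
Qed.

(** A function of [Cc strip] as a bounded continuous function of the whole
    space-time, so that global measurability and domination results apply. *)
Lemma Cc_strip_extension (f : V -> R^o) : Cc (@strip R d) f ->
  exists g : V -> R, exists r C : R, [/\ continuous g,
    forall z, strip z -> g z = f z, 0 <= r, forall z, `|g z| <= C &
    forall (z : V) i, r < `|z.1 ord0 i| -> g z = 0].
Proof.
move=> [cf [K [cK Ks fK]]].
have [r r0 Kr] := compact_strip_box cK.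
have cg := clamp_comp_continuous cf.
have supp (z : V) i : r < `|z.1 ord0 i| -> (f \o clamp) z = 0.
  move=> zi; apply: fK; first exact: clamp_strip.
  by move=> /Kr[/(_ i)/=]; rewrite leNgt zi.
have [C fC] : exists C, forall z, `|(f \o clamp) z| <= C.
  have : compact ((f \o clamp : V -> R^o) @` box r).
    apply: continuous_compact; last exact: compact_box01.
    exact: continuous_subspaceT.
  move=> /compact_bounded[M [_ HM]]; exists (`|M| + 1) => z.
  have M1 : M < `|M| + 1 by rewrite (le_lt_trans (ler_norm M)) ?ltrDl.
  have [zr|/existsNP[i /negP]] := pselect (forall i, `|z.1 ord0 i| <= r).
    apply: (HM _ M1) => /=; exists (clamp z); last first.
      by rewrite /= [clamp (clamp z)]clamp_id//; exact: clamp_strip.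
    by split => //; have [_ /=] := clamp_strip z; rewrite in_itv.
  by rewrite -ltNge => /supp ->; rewrite normr0 addr_ge0.
exists (f \o clamp), r, C; split => //.
by move=> z /clamp_id; rewrite /comp/= => ->.
Qed.

End strip_functions.

(** * The dual lower bound for the Eulerian cost *)

Lemma integrable_indic_finite d (T : measurableType d) (R : realType)
    (m : {measure set T -> \bar R}) (A : set T) : measurable A ->
  (m A < +oo)%E -> m.-integrable setT (EFin \o (\1_A : T -> R)).
Proof.
move=> mA mAy; apply/integrableP; split; first exact/measurable_EFinP.
under eq_integral do rewrite /= ger0_norm//.
by rewrite integral_indic// setIT.
Qed.

Lemma cvg_sum (R : realType) (T I : Type) (F : set_system T) (s : seq I)
    (f : I -> T -> R) (l : I -> R) : Filter F ->
  (forall i, f i t @[t --> F] --> l i) ->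
  (\sum_(i <- s) f i t) @[t --> F] --> \sum_(i <- s) l i.
Proof.
move=> FF fl; elim: s => [|i s IH].
  by under eq_fun do rewrite big_nil; rewrite big_nil; exact: cvg_cst.
by under eq_fun do rewrite big_cons; rewrite big_cons; exact: cvgD.
Qed.

Section continuity_dual.
Context {R : realType} {d : nat}.
Notation V := ('rV[R]_d * R)%type.

Lemma Cc_measurable (f : V -> R) : Cc (W := R^o) (@strip R d) f ->
  measurable_fun (@strip R d) f.
Proof.
move=> /Cc_strip_extension[g [r [C [cg gf _ _ _]]]].
apply: (eq_measurable_fun g).
  by move=> z; rewrite inE => /gf.
by apply: measurable_funTS; exact: continuous_measurable.
Qed.

Lemma Cc_integrable (m : {measure set V -> \bar R}) (f : V -> R) :
  locally_finite (@strip R d) m -> Cc (W := R^o) (@strip R d) f ->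
  m.-integrable (@strip R d) (EFin \o f).
Proof.
move=> mfin Cf; have [g [r [C [cg gf r0 gC g0]]]] := Cc_strip_extension Cf.
have ms := @measurable_strip R d.
have mb := @measurable_box R d r.
have fb z : strip z -> ~ box r z -> f z = 0%R.
  move=> zs nb; rewrite -gf//.
  have [i zi] : exists i, (r < `|z.1 ord0 i|)%R.
    apply: contrapT => /forallNP nz; apply: nb; split => [i|].
      by rewrite leNgt; apply/negP; exact: nz.
    by move: zs => [_ /=]; rewrite in_itv.
  exact: g0 zi.
apply: (@le_integrable _ _ _ _ _ ms _ (fun z => (C * \1_(box r) z)%:E)).
- by apply/measurable_EFinP; exact: Cc_measurable.
- move=> z zs /=; rewrite lee_fin indicE.
  have [zb|zb] := pselect (box r z).
    by rewrite mem_set// mulr1 -gf// (le_trans (gC z))// ler_norm.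
  by rewrite memNset// fb// normr0 mulr0 normr0.
- under eq_fun do rewrite EFinM.
  apply: integrableZl => //; apply: (@integrableS _ _ _ _ setT) => //.
  apply: integrable_indic_finite => //.
  by apply: mfin; [exact: compact_box01|exact: box_strip].
Qed.

Lemma Cc_coord (T : topologicalType) (D : set T) (xi : T -> 'rV[R]_d) i :
  Cc D xi -> Cc (W := R^o) D (fun z => xi z ord0 i).
Proof.
move=> [cxi [K [cK KD xi0]]]; split.
  move=> z; apply: (@continuous_comp (subspace _) _ _ xi (fun M : 'rV[R]_d => M ord0 i)).
    exact: cxi.
  exact: coord_continuous.
by exists K; split => // z Dz Kz; rewrite xi0// mxE.
Qed.

Lemma rV_continuous (T : topologicalType) (xi : T -> 'rV[R]_d) :
  (forall i, continuous (fun z => xi z ord0 i)) -> continuous xi.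
Proof.
move=> cxi z; apply/cvgrPdist_le => e e0.
have : \forall y \near z, forall i, `|xi z ord0 i - xi y ord0 i| <= e.
  apply: filter_forall => i.
  by have /cvgrPdist_le := cxi i z; exact.
apply: filterS => y zy; apply: rV_norm_le; first exact: ltW.
by move=> i; rewrite !mxE; exact: zy.
Qed.

Lemma continuous_Cc_strip (W : normedModType R) (f : V -> W) (r : R) :
  continuous f -> (forall z, r < `|z| -> f z = 0) -> Cc (@strip R d) f.
Proof.
move=> cf f0; split; first exact: continuous_subspaceT.
exists (box r); split; [exact: compact_box01|exact: box_strip|].
move=> z [_ z01] nb; apply: f0; rewrite ltNge; apply/negP => zr; apply: nb.
split; last by move: z01; rewrite /= in_itv.
move=> i; rewrite (le_trans _ zr)// prod_normE le_max; apply/orP; left.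
rewrite [leRHS]/Num.norm/= mx_normrE.
by apply: (le_bigmax _ (fun j => `|z.1 j.1 j.2|) (ord0, i)).
Qed.

Lemma Cc_smooth_support (f : V -> R) : Cc_smooth f -> exists r : R,
  (forall z, r < `|z| -> f z = 0) /\
  (forall z v, r < `|z| -> 'D_v (f : V -> R^o) z = 0).
Proof.
move=> [_ [_ [K [cK _ f0]]]].
have [M [_ HM]] := compact_bounded cK; exists (`|M| + 1).
have f0' z : `|M| + 1 < `|z| -> f z = 0.
  move=> zM; apply: f0 => // /(HM (`|M| + 1)).
  rewrite (le_lt_trans (ler_norm M)) ?ltrDl// => /(_ isT).
  by rewrite /= leNgt zM.
split=> // z v zM.
have Dcst : is_derive z v (cst 0 : V -> R^o) 0 by exact: is_derive_cst.
apply: (@derive_val _ _ _ _ _ _ _ (near_eq_is_derive _ Dcst)).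
near=> y; rewrite f0'//; near: y.
have := @norm_continuous _ V z.
by move=> /(_ _ (lt_nbhsr zM)).
Unshelve. all: by end_near. Qed.

Lemma Cc_time_derivative (f : V -> R) : Cc_smooth f ->
  Cc (W := R^o) (@strip R d) (time_derivative f).
Proof.
move=> Cf; have [r [_ r0]] := Cc_smooth_support Cf.
apply: (@continuous_Cc_strip _ _ r); last by move=> z /r0; exact.
by have [/(_ [:: ((0 : 'rV[R]_d), (1 : R))])[cf _] _] := Cf; exact: cf.
Qed.

Lemma Cc_space_gradient (f : V -> R) : Cc_smooth f ->
  Cc (@strip R d) (space_gradient f).
Proof.
move=> Cf; have [r [_ r0]] := Cc_smooth_support Cf.
apply: (@continuous_Cc_strip _ _ r); last first.
  by move=> z /r0 Dz; apply/rowP => i; rewrite !mxE Dz.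
apply: rV_continuous => i.
under eq_fun do rewrite mxE.
by have [/(_ [:: ((delta_mx ord0 i : 'rV[R]_d), (0 : R))])[cf _] _] := Cf; exact: cf.
Qed.

Lemma sqnorm_continuous : continuous (@sqnorm R d).
Proof.
move=> v; apply: (@cvg_sum R _ _ (nbhs v) _
    (fun i (v : 'rV[R]_d) => v ord0 i * v ord0 i)) => i.
by apply: cvgM; exact: coord_continuous.
Qed.

Lemma Cc_sqnorm (xi : V -> 'rV[R]_d) : Cc (@strip R d) xi ->
  Cc (W := R^o) (@strip R d) (fun z => sqnorm (xi z) / 2).
Proof.
move=> [cxi [K [cK KD xi0]]]; split.
  move=> z.
  apply: (@continuous_comp (subspace _) _ _ xi (fun v : 'rV[R]_d => sqnorm v / 2)).
    exact: cxi.
  exact: cvgM (@sqnorm_continuous (xi z)) (cvg_cst _).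
exists K; split => // z Dz Kz; rewrite xi0// /sqnorm /dotv big1 ?mul0r// => i _.
by rewrite mxE mul0r.
Qed.

(** For a subsolution [f], the continuity equation bounds the difference of the
    boundary integrals by the value of the supremum that defines the Eulerian
    cost at the field [space_gradient f]. *)
Lemma hj_dual_bound (mu nu : {measure set 'rV[R]_d -> \bar R})
    (rho : {measure set V -> \bar R}) (j : vmeasure R d V) (f : V -> R) :
  density_flux rho j -> continuity_equation mu nu rho j -> Cc_smooth f ->
  (forall z, strip z ->
     time_derivative f z + sqnorm (space_gradient f z) / 2 <= 0) ->
  (\int[nu]_y (f (y, 1%R))%:E - \int[mu]_x (f (x, 0%R))%:E <=
    eulerian_cost rho j)%E.
Proof.
move=> [rfin jfin] CE Cf sub; rewrite -CE//.
have Cg := Cc_space_gradient Cf.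
have ms := @measurable_strip R d.
(* Every field gives a lower bound of the supremum; take the gradient of f. *)
apply: (@le_trans _ _ (vintegral j (@strip R d) (space_gradient f) -
    \int[rho]_(z in @strip R d) (sqnorm (space_gradient f z) / 2)%:E)%E); last first.
  by apply: ereal_sup_ubound; exists (space_gradient f).
rewrite addeC leeD2l//.
have Ir := Cc_integrable rfin (Cc_time_derivative Cf).
have Is := Cc_integrable rfin (Cc_sqnorm Cg).
rewrite -integralN; last first.
  exact: integrable_add_def.
apply: le_integral => //; first exact: integrableN.
by move=> z; rewrite inE => zs; rewrite -EFinN lee_fin; have := sub z zs; lra.
Qed.

End continuity_dual.

(** * Squared norms and integrals of finitely valued functions *)

Section sqnorm.
Context {R : realType} {d : nat}.
Implicit Types u v : 'rV[R]_d.

Lemma sqnorm_ge0 u : 0 <= sqnorm u.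
Proof. by apply: sumr_ge0 => i _; exact: sqr_ge0. Qed.

Lemma sqnormN u : sqnorm (- u) = sqnorm u.
Proof. by apply: eq_bigr => i _; rewrite !mxE mulrNN. Qed.

Lemma sqnorm_young (t : R) u v : 0 < t ->
  sqnorm (u + v) <= (1 + t) * sqnorm u + (1 + t^-1) * sqnorm v.
Proof.
move=> t0; rewrite /sqnorm /dotv !mulr_sumr -big_split ler_sum// => i _ /=.
rewrite !mxE; set a := u _ _; set b := v _ _.
rewrite -subr_ge0.
have -> : (1 + t) * (a * a) + (1 + t^-1) * (b * b) - (a + b) * (a + b) =
    t^-1 * (t * a - b) ^+ 2 by field; rewrite gt_eqF.
by rewrite mulr_ge0 ?sqr_ge0// invr_ge0 ltW.
Qed.

End sqnorm.

Section finite_factor.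
Local Open Scope ereal_scope.
Context {R : realType} d (T : measurableType d) (m : {finite_measure set T -> \bar R}).
Context {I : finType} (q : T -> I) (a : I -> R).
Hypothesis mq : forall i, measurable [set y | q y = i].

Let factor_sum y : (a (q y))%:E = \sum_i (a i)%:E * (\1_[set y | q y = i] y : R)%:E.
Proof.
rewrite (bigD1 (q y))//= big1 ?adde0.
  by rewrite indicE mem_set// mule1.
by move=> i iq; rewrite indicE memNset ?mule0// => /= qi; rewrite qi eqxx in iq.
Qed.

Let integrable_term i :
  m.-integrable setT (fun y => (a i)%:E * (\1_[set y | q y = i] y : R)%:E).
Proof. by apply: integrableZl => //; exact: integrable_indic. Qed.

Lemma integrable_finite_factor : m.-integrable setT (fun y => (a (q y))%:E).
Proof.
by under eq_fun do rewrite factor_sum; exact: integrable_sum.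
Qed.

Lemma integral_finite_factor :
  \int[m]_y (a (q y))%:E = \sum_i (a i)%:E * m [set y | q y = i].
Proof.
under eq_integral do rewrite factor_sum.
rewrite integral_sum//; apply: eq_bigr => i _.
by rewrite integralZl//; [rewrite integral_indic// setIT|exact: integrable_indic].
Qed.

End finite_factor.

(** * Kantorovich duality for finitely many cells *)

(** The cells are the fibers of [q], with centers [x]; those of index at least
    [L] are merged into a single cell [ord_max], at cost zero from every cell.
    The size [delta] of the cells also controls the shift of the initial time in
    the test functions, so that a single parameter has to tend to zero. The
    constant [final_time] is an upper bound of the corrected time at [1], and
    the cost of the remaining cells is lowered by [cost_factor] to absorb both
    this bound and the distance to the centers. *)
Section level.
Context {R : realType} {d : nat}.
Notation V := ('rV[R]_d * R)%type.
Context (mu nu : {finite_measure set 'rV[R]_d -> \bar R}).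
Context (rho : {measure set V -> \bar R}) (j : vmeasure R d V).
Context (q : 'rV[R]_d -> nat) (x : nat -> 'rV[R]_d) (delta e : R).

Definition final_time : R := delta + expR delta * (1 + delta).

Definition cost_factor : R := (final_time * (1 + delta))^-1.

Definition cell (L : nat) (y : 'rV[R]_d) : 'I_L.+1 := inord (minn (q y) L).

Definition cell_mass (m : {finite_measure set 'rV[R]_d -> \bar R}) L (i : 'I_L.+1) :=
  fine (m [set y | cell L y = i]).

Definition cell_cost (L : nat) (i k : 'I_L.+1) : R :=
  if (i == ord_max) || (k == ord_max) then 0
  else cost_factor * (sqnorm (x i - x k) / 2).

Hypothesis mass_eq : mu setT = nu setT.
Hypothesis rho_j : density_flux rho j.
Hypothesis CE : continuity_equation mu nu rho j.
Hypothesis cost_le : (eulerian_cost rho j <= e%:E)%E.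
Hypothesis delta01 : 0 < delta <= 1.
Hypothesis mq : forall k, measurable [set y | q y = k].
Hypothesis near_center : forall y, sqnorm (y - x (q y)) <= delta ^+ 2.

Let delta0 : 0 < delta. Proof. by case/andP: delta01. Qed.

Let final_time_ge1 : 1 <= final_time.
Proof.
rewrite /final_time; have := expR_ge1Dx delta.
by move: delta0; nra.
Qed.

Lemma measurable_cell L i : measurable [set y | cell L y = i].
Proof.
have m1 : measurable [set true] by [].
have := @measurable_fun_countable _ _ _ _ nat q
  (fun k => (inord (minn k L) : 'I_L.+1) == i) mq measurableT _ m1.
by rewrite setTI; congr measurable; apply/seteqP; split => y /eqP.
Qed.

Lemma cell_lt L y : (q y < L)%N -> cell L y = q y :> nat.
Proof. by move=> qL; rewrite /cell inordK (minn_idPl (ltnW qL))// leqW. Qed.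

Lemma cell_max L y : (cell L y == ord_max) = (L <= q y)%N.
Proof.
rewrite -val_eqE/= /cell inordK; last by rewrite ltnS geq_minr.
by rewrite eqn_leq geq_minr leq_min leqnn andbT.
Qed.

Lemma integral_cell (m : {finite_measure set 'rV[R]_d -> \bar R}) L
    (a : 'I_L.+1 -> R) :
  (\int[m]_y (a (cell L y))%:E = (\sum_i a i * cell_mass m i)%:E)%E.
Proof.
rewrite (integral_finite_factor _ _ (measurable_cell (L := L))) -sumEFin.
apply: eq_bigr => i _; rewrite EFinM fineK// fin_num_measure//.
exact: measurable_cell.
Qed.

Lemma integrable_cell (m : {finite_measure set 'rV[R]_d -> \bar R}) L
    (a : 'I_L.+1 -> R) :
  m.-integrable setT (fun y => (a (cell L y))%:E).
Proof. exact: (integrable_finite_factor _ _ (measurable_cell (L := L))). Qed.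

Lemma cell_mass_sum (m : {finite_measure set 'rV[R]_d -> \bar R}) L :
  \sum_(i < L.+1) cell_mass m i = fine (m setT).
Proof.
have := integral_cell m (fun _ : 'I_L.+1 => 1).
rewrite integral_cst// mul1e => ->.
by apply: eq_bigr => i _; rewrite mul1r.
Qed.

Lemma integrable_slice (m : {finite_measure set 'rV[R]_d -> \bar R})
    (f : V -> R) (t : R) : Cc_smooth f -> 0 <= t <= 1 ->
  m.-integrable setT (fun y => (f (y, t))%:E).
Proof.
move=> Cf t01; have [r [r0 _]] := Cc_smooth_support Cf.
have cf : continuous (f : V -> R^o).
  by have [/(_ [::])[cf _] _] := Cf; exact: cf.
have [g [r' [C [cg gf _ gC _]]]] := Cc_strip_extension (continuous_Cc_strip cf r0).
apply: measurable_bounded_integrable => //.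
- by rewrite ltey_eq fin_num_measure.
- apply: (measurable_continuous_comp cf); last exact: measurable_cst.
  exact: measurable_coord.
- exists C; split; first exact: num_real.
  move=> M CM y _ /=; rewrite -gf; first exact: le_trans (gC _) (ltW CM).
  by split => //=; rewrite in_itv.
Qed.

(** The function of [hamilton_jacobi_test_function] built on [phi] lies below
    [phi] at time [0] and above [psi] at time [1], up to multiples of [delta].
    Normalizing the potential of the merged cell to zero accounts for the
    points of that cell, where the test function is only known to be
    nonpositive. *)
Lemma level_dual L (phi psi : 'I_L.+1 -> R) : (0 < L)%N ->
  (forall i k, psi k - phi i <= cell_cost i k) ->
  \sum_k psi k * cell_mass nu k - \sum_i phi i * cell_mass mu i <=
    e + 4 * delta * fine (mu setT).
Proof.
move=> L0 dual.
set M := fine (mu setT).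
have ME : M = fine (nu setT) by rewrite /M mass_eq.
(* Both potentials are shifted by the same constant, which does not change
   the dual functional as [mu] and [nu] have the same mass. *)
pose a := phi ord_max; pose phi' i := phi i - a; pose psi' i := psi i - a.
have shift (m : {finite_measure set 'rV[R]_d -> \bar R}) (f : 'I_L.+1 -> R) :
    \sum_i (f i - a) * cell_mass m i = \sum_i f i * cell_mass m i - a * fine (m setT).
  under eq_bigr do rewrite mulrBl.
  by rewrite sumrB -mulr_sumr cell_mass_sum.
have dual' i k : psi' k - phi' i <= cell_cost i k.
  by have := dual i k; rewrite /psi' /phi'; lra.
have phi'0 : phi' ord_max = 0 by rewrite /phi' subrr.
have psi'0 k : psi' k <= 0.
  by have := dual' ord_max k; rewrite /cell_cost eqxx phi'0 subr0.
have -> : \sum_k psi k * cell_mass nu k - \sum_i phi i * cell_mass mu i =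
    \sum_k psi' k * cell_mass nu k - \sum_i phi' i * cell_mass mu i.
  by rewrite !shift -ME -/M; lra.
pose emb (i : 'I_L) : 'I_L.+1 := widen_ord (leqnSn L) i.
have [f [Cf sub f_le0 f0 f1]] := hamilton_jacobi_test_function (Ordinal L0)
  (fun i : 'I_L => x i) (fun i => phi' (emb i)) delta0 delta0.
have f_initial y : f (y, 0) <= phi' (cell L y) + (delta / 2 + delta).
  have [qL|Lq] := ltnP (q y) L; last first.
    have /eqP -> : cell L y == ord_max by rewrite cell_max.
    by rewrite phi'0; move: (f_le0 (y, 0)) delta0; lra.
  have -> : cell L y = emb (Ordinal qL) by apply: val_inj; rewrite /= cell_lt.
  have := f0 y (Ordinal qL) => /=.
  have : sqnorm (y - x (q y)) / (2 * delta) <= delta / 2.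
    rewrite ler_pdivrMr ?mulr_gt0//; apply: le_trans (near_center y) _.
    by rewrite expr2; move: delta0; nra.
  by lra.
have f_final y : psi' (cell L y) - (delta + delta) <= f (y, 1).
  rewrite opprD addrA; apply: f1.
    by have := psi'0 (cell L y); move: delta0; lra.
  move=> i; have := dual' (emb i) (cell L y); rewrite /cell_cost.
  have -> : (emb i == ord_max) = false by rewrite -val_eqE/= ltn_eqF.
  have nn : 0 <= sqnorm (y - x i) / (2 * final_time).
    by rewrite divr_ge0 ?sqnorm_ge0// mulr_ge0// (le_trans _ final_time_ge1).
  rewrite -/final_time /= cell_max; case: leqP => [_|qL].
    by move: delta0; lra.
  rewrite (cell_lt qL)/=.
  suff : cost_factor * (sqnorm (x i - x (q y)) / 2) <=
      sqnorm (y - x i) / (2 * final_time) + delta by lra.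
  have yg : sqnorm (x i - x (q y)) <= (1 + delta) * sqnorm (y - x i) +
      (1 + delta^-1) * delta ^+ 2.
    have -> : x i - x (q y) = - (y - x i) + (y - x (q y)).
      by rewrite opprB addrA subrK.
    apply: le_trans (sqnorm_young _ _ delta0) _; rewrite sqnormN lerD2l.
    by rewrite ler_wpM2l// addr_ge0// invr_ge0 ltW.
  have d1 : (1 + delta^-1) * delta ^+ 2 <= 2 * delta.
    have -> : (1 + delta^-1) * delta ^+ 2 = delta ^+ 2 + delta.
      by field; rewrite gt_eqF.
    by move/andP : delta01 => [? ?]; nra.
  rewrite /cost_factor mulrC ler_pdivrMr; last first.
    by rewrite mulr_gt0// (lt_le_trans _ final_time_ge1, addr_gt0).
  have -> : (sqnorm (y - x i) / (2 * final_time) + delta) * (final_time * (1 + delta))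
     = ((1 + delta) * sqnorm (y - x i)) / 2 + delta * (final_time * (1 + delta)).
    by field; rewrite gt_eqF// (lt_le_trans _ final_time_ge1).
  have : 1 <= final_time * (1 + delta).
    by have := final_time_ge1; move: delta0; nra.
  by move: delta0; nra.
have t0 : (0 <= (0 : R) <= 1)%R by rewrite lexx ler01.
have t1 : (0 <= (1 : R) <= 1)%R by rewrite lexx ler01.
have I0 := integrable_slice mu Cf t0; have I1 := integrable_slice nu Cf t1.
have b0 : (\int[mu]_y (f (y, 0%R))%:E <=
    (\sum_i phi' i * cell_mass mu i + (delta / 2 + delta) * M)%:E)%E.
  have -> : \sum_i phi' i * cell_mass mu i + (delta / 2 + delta) * M =
      \sum_i (phi' i + (delta / 2 + delta)) * cell_mass mu i.
    under [RHS]eq_bigr do rewrite mulrDl.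
    by rewrite big_split/= -mulr_sumr cell_mass_sum.
  rewrite -integral_cell; apply: le_integral => //.
    exact: (integrable_cell mu (fun i => phi' i + (delta / 2 + delta))).
  by move=> y _; rewrite lee_fin.
have b1 : ((\sum_i psi' i * cell_mass nu i - (delta + delta) * M)%:E <=
    \int[nu]_y (f (y, 1%R))%:E)%E.
  have -> : \sum_i psi' i * cell_mass nu i - (delta + delta) * M =
      \sum_i (psi' i - (delta + delta)) * cell_mass nu i.
    under [RHS]eq_bigr do rewrite mulrBl.
    by rewrite sumrB -mulr_sumr cell_mass_sum -ME.
  rewrite -integral_cell; apply: le_integral => //.
    exact: (integrable_cell nu (fun i => psi' i - (delta + delta))).
  by move=> y _; rewrite lee_fin.
have := le_trans (hj_dual_bound rho_j CE Cf sub) cost_le.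
move: b0 b1.
rewrite -(fineK (integrable_fin_num measurableT I0)).
rewrite -(fineK (integrable_fin_num measurableT I1)) -EFinB !lee_fin.
have M0 : 0 <= M by rewrite fine_ge0.
by move: delta0; nra.
Qed.

End level.

(** * From finitely to countably many cells *)

Lemma ultra_fmap (S T : Type) (f : S -> T) (U : set_system S) :
  UltraFilter U -> UltraFilter (fmap f U).
Proof.
move=> UU; split; first exact: fmap_proper_filter.
move=> G PG UG.
(* A set of G outside of the image filter would have its complement in the
   image filter, hence in G. *)
apply/seteqP; split=> // A GA.
have [//|nA] := in_ultra_setVsetC (f @^-1` A) UU.
have GnA : G (~` A) by exact: UG.
by have := filter_ex (filterI GA GnA) => -[t []].
Qed.

(** Along an ultrafilter every bounded sequence converges, hence all entries
    converge simultaneously. *)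
Lemma diagonal_limit (R : realType) (P : nat -> nat -> nat -> R) (M : R) :
  (forall L i k, 0 <= P L i k <= M) ->
  exists (U : set_system nat) (p : nat -> nat -> R),
    [/\ ProperFilter U, \oo `<=` U &
        forall i k, P L i k @[L --> U] --> p i k].
Proof.
move=> bP; have [U [UU ooU]] := @ultraFilterLemma _ \oo _.
have lim i k : exists l : R, P L i k @[L --> U] --> l.
  have cM : compact `[0, M]%classic by exact: segment_compact.
  move: cM; rewrite compact_ultra.
  move=> /(_ (fmap (fun L => P L i k) U) (ultra_fmap _ UU))[].
    apply: (@filterS _ U _ setT) => [L _|]; last exact: filterT.
    by rewrite /= in_itv; exact: bP.
  by move=> l [_ lP]; exists l.
exists U, (fun i k => sval (cid (lim i k))).
split; [exact: ultra_proper|exact: ooU|].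
by move=> i k; exact: (svalP (cid (lim i k))).
Qed.

Section countable.
Context {R : realType} {d : nat}.
Notation V := ('rV[R]_d * R)%type.
Context (mu nu : {finite_measure set 'rV[R]_d -> \bar R}).
Context (rho : {measure set V -> \bar R}) (j : vmeasure R d V).
Context (q : 'rV[R]_d -> nat) (x : nat -> 'rV[R]_d) (delta e : R).

Hypothesis mass_eq : mu setT = nu setT.
Hypothesis rho_j : density_flux rho j.
Hypothesis CE : continuity_equation mu nu rho j.
Hypothesis cost_le : (eulerian_cost rho j <= e%:E)%E.
Hypothesis delta01 : 0 < delta <= 1.
Hypothesis mq : forall k, measurable [set y | q y = k].
Hypothesis near_center : forall y, sqnorm (y - x (q y)) <= delta ^+ 2.

Definition mass (m : {finite_measure set 'rV[R]_d -> \bar R}) (k : nat) : R :=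
  fine (m [set y | q y = k]).

Definition tail (m : {finite_measure set 'rV[R]_d -> \bar R}) (F : nat) : R :=
  fine (m setT) - \sum_(0 <= k < F) mass m k.

Let M := fine (mu setT).
Let E := e + 4 * delta * M.
Let cost i k := cost_factor delta * (sqnorm (x i - x k) / 2).

Lemma cell_mass_mass m L (i : nat) : (i < L)%N ->
  cell_mass q m (inord i : 'I_L.+1) = mass m i.
Proof.
move=> iL; rewrite /cell_mass /mass; congr (fine (m _)).
have iE : (inord i : 'I_L.+1) = i :> nat by rewrite inordK// ltnW.
apply/seteqP; split => y /=.
  move=> yi; move: (congr1 val yi); rewrite /= iE => <-.
  rewrite cell_lt//; apply: contraT; rewrite -leqNgt -cell_max yi -val_eqE/= iE.
  by rewrite ltn_eqF.
by move=> yi; apply: val_inj; rewrite /= iE cell_lt yi.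
Qed.

(** The inequalities between finite sums which survive the passage to the limit
    and, because [tail] tends to zero, determine the marginals of the limit. *)
Definition marginal_bounds (P : nat -> nat -> R) (F : nat) :=
  [/\ forall i, (i < F)%N ->
        mass mu i - tail nu F <= \sum_(0 <= k < F) P i k <= mass mu i,
      forall k, (k < F)%N ->
        mass nu k - tail mu F <= \sum_(0 <= i < F) P i k <= mass nu k &
      \sum_(0 <= i < F) \sum_(0 <= k < F) P i k * cost i k <= E].

(** The mass which a row loses outside the first [F] columns is at most the
    total mass of these other columns. *)
Lemma row_bounds (m n : {finite_measure set 'rV[R]_d -> \bar R}) L
    (p : 'I_L.+1 -> 'I_L.+1 -> R) (F i : nat) :
  (forall i k, 0 <= p i k) -> (forall i, \sum_k p i k = cell_mass q m i) ->
  (forall k, \sum_i p i k = cell_mass q n k) ->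
  (i < F)%N -> (F <= L)%N ->
  mass m i - tail n F <= \sum_(0 <= k < F) p (inord i) (inord k) <= mass m i.
Proof.
move=> p0 prow pcol iF FL.
have sumE (f : 'I_L.+1 -> R) : \sum_k f k =
    \sum_(0 <= k < F) f (inord k) + \sum_(F <= k < L.+1) f (inord k).
  rewrite -big_cat_nat//=; last by rewrite leqW.
  by rewrite big_mkord; apply: eq_bigr => k _; rewrite inord_val.
rewrite -(cell_mass_mass m (leq_trans iF FL)) -prow sumE.
apply/andP; split; last by rewrite lerDl sumr_ge0.
have -> : tail n F = \sum_(F <= k < L.+1) cell_mass q n (inord k : 'I_L.+1).
  rewrite /tail -(cell_mass_sum mq n L) sumE.
  rewrite (@eq_big_nat _ _ _ 0%N F (fun k => cell_mass q n (inord k : 'I_L.+1)) (mass n)).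
    by rewrite addrAC subrr add0r.
  by move=> k /andP[_ kF]; rewrite cell_mass_mass// (leq_trans kF).
rewrite lerBlDr lerD2l ler_sum// => k _; rewrite -pcol.
by rewrite (bigD1 (inord i))//= lerDl sumr_ge0.
Qed.

Lemma level_coupling L : (0 < L)%N -> exists P : nat -> nat -> R,
  (forall i k, 0 <= P i k <= M) /\ forall F, (F <= L)%N -> marginal_bounds P F.
Proof.
move=> L0.
have ft : 0 <= cost_factor delta.
  rewrite invr_ge0 mulr_ge0//; move/andP : delta01 => [d0 _].
    by rewrite addr_ge0 ?mulr_ge0 ?expR_ge0 ?addr_ge0 ?ltW.
  by rewrite addr_ge0 ?ltW.
have c0 i k : 0 <= cell_cost x delta (i : 'I_L.+1) k.
  rewrite /cell_cost; case: ifP => // _.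
  by rewrite mulr_ge0// divr_ge0// sqnorm_ge0.
have [p [p0 prow pcol pcost]] := finite_coupling c0
  (fun phi psi => level_dual mass_eq rho_j CE cost_le delta01 mq near_center L0).
exists (fun i k => p (inord i) (inord k)); split.
  move=> i k; rewrite p0/= /M -(cell_mass_sum mq mu L).
  under eq_bigr do rewrite -prow.
  rewrite (bigD1 (inord i))//= (bigD1 (inord k))//= -addrA lerDl.
  by rewrite addr_ge0// ?sumr_ge0// => l _; rewrite sumr_ge0.
move=> F FL; split.
- by move=> i iF; exact: (row_bounds p0 prow pcol iF FL).
- move=> k kF.
  exact: (@row_bounds nu mu L (fun k i => p i k) F k (fun _ _ => p0 _ _) pcol prow kF FL).
- apply: le_trans pcost.
  have sumE (f : 'I_L.+1 -> R) : (forall k, 0 <= f k) ->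
      \sum_(0 <= k < F) f (inord k) <= \sum_k f k.
    move=> f0.
    have -> : \sum_k f k = \sum_(0 <= k < L.+1) f (inord k).
      by rewrite big_mkord; apply: eq_bigr => k _; rewrite inord_val.
    by rewrite (@big_cat_nat _ _ _ F 0%N L.+1)//= ?leqW// lerDl sumr_ge0.
  apply: (le_trans _ (sumE (fun i => \sum_k p i k * cell_cost x delta i k) _));
    last first.
    by move=> i; rewrite sumr_ge0// => k _; rewrite mulr_ge0.
  rewrite !big_mkord ler_sum// => i _.
  apply: (le_trans _ (sumE (fun k => p _ k * cell_cost x delta _ k) _)); last first.
    by move=> k; rewrite mulr_ge0.
  rewrite !big_mkord ler_sum// => k _; rewrite ler_wpM2l// /cell_cost.
  have lt (l : 'I_F) : (l < L.+1)%N by rewrite (leq_trans (ltn_ord l))// ltnW.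
  rewrite -!val_eqE/= !inordK//.
  by rewrite !ltn_eqF// (leq_trans (ltn_ord _)).
Qed.

Lemma countable_coupling : exists p : nat -> nat -> R,
  (forall i k, 0 <= p i k) /\ forall F, marginal_bounds p F.
Proof.
have /choice[P PP] : forall L, exists P : nat -> nat -> R,
    (forall i k, 0 <= P i k <= M) /\
    forall F, (F <= L.+1)%N -> marginal_bounds P F.
  by move=> L; exact: level_coupling.
have [U [p [PU ooU Pp]]] := diagonal_limit (fun L => (PP L).1).
have sum_cvg (F : nat) (f : nat -> nat -> R) (l : nat -> R) :
    (forall k, f k L @[L --> U] --> l k) ->
    \sum_(0 <= k < F) f k L @[L --> U] --> \sum_(0 <= k < F) l k.
  by move=> fl; exact: cvg_sum.
have U_le (f : nat -> R) (a b : R) N : f L @[L --> U] --> a ->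
    (forall L, (N <= L)%N -> f L <= b) -> a <= b.
  move=> fa fb; apply: (cvgr_to_le fa).
  by apply: ooU; exists N.
have U_ge (f : nat -> R) (a b : R) N : f L @[L --> U] --> a ->
    (forall L, (N <= L)%N -> b <= f L) -> b <= a.
  move=> fa fb; apply: (cvgr_to_ge fa).
  by apply: ooU; exists N.
exists p; split => [i k|F].
  by apply: (U_ge _ _ _ 0%N (Pp i k)) => L _; have /andP[] := (PP L).1 i k.
have PF L : (F <= L)%N -> marginal_bounds (P L) F.
  by move=> FL; apply: (PP L).2; rewrite leqW.
split => [i iF|k kF|].
- have c := sum_cvg F _ _ (fun k => Pp i k).
  by apply/andP; split; [apply: (U_ge _ _ _ F c)|apply: (U_le _ _ _ F c)] => L /PF[H _ _];
    have /andP[] := H i iF.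
- have c := sum_cvg F _ _ (fun i => Pp i k).
  by apply/andP; split; [apply: (U_ge _ _ _ F c)|apply: (U_le _ _ _ F c)] => L /PF[_ H _];
    have /andP[] := H k kF.
- have c : \sum_(0 <= i < F) \sum_(0 <= k < F) P L i k * cost i k @[L --> U] -->
      \sum_(0 <= i < F) \sum_(0 <= k < F) p i k * cost i k.
    by apply: (sum_cvg F) => i; apply: (sum_cvg F) => k; apply: cvgMr_tmp; exact: Pp.
  by apply: (U_le _ _ _ F c) => L /PF[].
Qed.

End countable.

(** * From a coupling of cells to a coupling of measures *)

(** On the product of two cells, the mass prescribed by [p] is distributed
    proportionally to the product of the two measures. *)
Section glue.
Local Open Scope ereal_scope.
Context {R : realType} d (T : measurableType d).
Context (mu nu : {finite_measure set T -> \bar R}) (q : T -> nat).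
Context (p : nat -> nat -> R).
Hypothesis mq : forall k, measurable [set y | q y = k].
Hypothesis p0 : forall i k, (0 <= p i k)%R.
Hypothesis prow : forall i, \sum_(k <oo) (p i k)%:E = mu [set y | q y = i].
Hypothesis pcol : forall k, \sum_(i <oo) (p i k)%:E = nu [set y | q y = k].

Let A k := [set y | q y = k].
Let m (n : {finite_measure set T -> \bar R}) k := fine (n (A k)).

Let mE (n : {finite_measure set T -> \bar R}) k : n (A k) = (m n k)%:E.
Proof. by rewrite fineK// fin_num_measure//; exact: mq. Qed.

Let m_ge0 (n : {finite_measure set T -> \bar R}) k : (0 <= m n k)%R.
Proof. by rewrite fine_ge0. Qed.

(** The convention [r / 0 = 0] is the right one for null cells, where [p]
    vanishes. *)
Let dens i k := (p i k / (m mu i * m nu k))%R.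

Let dens0 i k : (0 <= dens i k)%R.
Proof. by rewrite divr_ge0// mulr_ge0. Qed.

Let block i k := A i `*` A k.

Let mblock i k : measurable (block i k).
Proof. by apply: measurableX; exact: mq. Qed.

Let piece i k := mscale (NngNum (dens0 i k)) (mrestr (mu \x nu) (mblock i k)).

Definition glued : {measure set (T * T) -> \bar R} :=
  mseries (fun i => mseries (fun k => piece i k) 0) 0.

Let gluedE C : glued C = \sum_(i <oo) \sum_(k <oo)
  (dens i k)%:E * (mu \x nu) (C `&` block i k).
Proof. by []. Qed.

Let p_le_row i k : (p i k <= m mu i)%R.
Proof.
rewrite -lee_fin -mE -prow; apply: le_trans (nneseries_lim_ge k.+1 _).
  by rewrite big_nat_recr//= leeDr// sume_ge0// => ? _; rewrite lee_fin.
by move=> *; rewrite lee_fin.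
Qed.

Let p_le_col i k : (p i k <= m nu k)%R.
Proof.
rewrite -lee_fin -mE -pcol; apply: le_trans (nneseries_lim_ge i.+1 _).
  by rewrite big_nat_recr//= leeDr// sume_ge0// => ? _; rewrite lee_fin.
by move=> *; rewrite lee_fin.
Qed.

Let densK i k : (dens i k * (m mu i * m nu k))%R = p i k.
Proof.
rewrite /dens; have [/eqP|mm] := eqVneq (m mu i * m nu k)%R 0%R; last by rewrite divfK.
rewrite mulf_eq0 => /orP[] /eqP m0.
  have := p_le_row i k; rewrite m0 mul0r mulr0 => p_le.
  by apply/eqP; rewrite eq_le p0 p_le.
by have := p_le_col i k; rewrite m0 !mulr0 => p_le; apply/eqP; rewrite eq_le p0 p_le.
Qed.

Lemma measure_cells (n : {finite_measure set T -> \bar R}) B : measurable B ->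
  \sum_(i <oo) n (B `&` [set y | q y = i]) = n B.
Proof.
move=> mB; have mBA i : measurable (B `&` A i) by apply: measurableI => //; exact: mq.
have BE : \bigcup_i (B `&` A i) = B.
  by apply/seteqP; split => [y [i _ []//]|y By]; exists (q y).
have tB : trivIset setT (fun i => B `&` A i).
  by apply/trivIsetP => i k _ _ ik; apply/seteqP; split => y //= [[_ yi] [_ yk]];
    move: ik; rewrite -yi -yk eqxx.
have := @measure_semi_bigcup _ _ _ n _ mBA tB.
by rewrite BE => ->//.
Qed.

Let prodE B C i k : measurable B -> measurable C ->
  (mu \x nu) ((B `*` C) `&` block i k) = mu (B `&` A i) * nu (C `&` A k).
Proof.
move=> mB mC; rewrite -setXI product_measure1E//; apply: measurableI => //; exact: mq.
Qed.

Let part (n : {finite_measure set T -> \bar R}) B i := fine (n (B `&` A i)).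

Let partE (n : {finite_measure set T -> \bar R}) B i : measurable B ->
  n (B `&` A i) = (part n B i)%:E.
Proof.
move=> mB; rewrite fineK// fin_num_measure//.
by apply: measurableI => //; exact: mq.
Qed.

Let part_null (n : {finite_measure set T -> \bar R}) B i : measurable B ->
  m n i = 0%R -> part n B i = 0%R.
Proof.
move=> mB m0; apply/eqP; rewrite eq_le fine_ge0// andbT -m0 -lee_fin -mE -partE//.
have mA := mq i; rewrite le_measure ?inE//; exact: measurableI.
Qed.

Let glued_row B : measurable B -> glued (B `*` setT) = mu B.
Proof.
move=> mB; rewrite gluedE -(measure_cells mu mB); apply: eq_eseriesr => i _.
transitivity (\sum_(k <oo) (part mu B i / m mu i)%:E * (p i k)%:E).
  apply: eq_eseriesr => k _; rewrite prodE// setTI mE partE// -!EFinM.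
  congr EFin; rewrite -(densK i k).
  have [m0|m0] := eqVneq (m mu i) 0%R; last by field.
  by rewrite part_null// m0 !(mul0r, mulr0).
rewrite nneseriesZl; last by move=> k _; rewrite lee_fin.
rewrite prow -/(A i) mE partE// -EFinM; congr EFin.
have [m0|m0] := eqVneq (m mu i) 0%R; last by rewrite divfK.
by rewrite part_null// m0 !(mul0r, mulr0).
Qed.

Let glued_col B : measurable B -> glued (setT `*` B) = nu B.
Proof.
move=> mB; rewrite gluedE nneseries_interchange; last first.
  by move=> i k; rewrite mule_ge0// lee_fin.
rewrite -(measure_cells nu mB); apply: eq_eseriesr => k _.
transitivity (\sum_(i <oo) (part nu B k / m nu k)%:E * (p i k)%:E).
  apply: eq_eseriesr => i _; rewrite prodE// setTI mE partE// -!EFinM.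
  congr EFin; rewrite -(densK i k).
  have [m0|m0] := eqVneq (m nu k) 0%R; last by field.
  by rewrite part_null// m0 !(mul0r, mulr0).
rewrite nneseriesZl; last by move=> i _; rewrite lee_fin.
rewrite pcol -/(A k) mE partE// -EFinM; congr EFin.
have [m0|m0] := eqVneq (m nu k) 0%R; last by rewrite divfK.
by rewrite part_null// m0 !(mul0r, mulr0).
Qed.

Lemma glued_marginals B : measurable B ->
  glued (B `*` setT) = mu B /\ glued (setT `*` B) = nu B.
Proof. by move=> mB; split; [exact: glued_row|exact: glued_col]. Qed.

Lemma nneseries2_le (u : nat -> nat -> R) (b : R) : (forall i k, 0 <= u i k)%R ->
  (forall F, \sum_(0 <= i < F) \sum_(0 <= k < F) u i k <= b)%R ->
  \sum_(i <oo) \sum_(k <oo) (u i k)%:E <= b%:E.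
Proof.
move=> u0 ub; apply: lime_le.
  by apply: is_cvg_nneseries => i _ _; apply: nneseries_ge0 => k _ _; rewrite lee_fin.
apply: nearW => I; rewrite -nneseries_sum_nat; last by move=> *; rewrite lee_fin.
apply: lime_le.
  by apply: is_cvg_nneseries => k _ _; apply: sume_ge0 => i _; rewrite lee_fin.
apply: nearW => K; apply: le_trans (_ : (\sum_(0 <= i < maxn I K)
    \sum_(0 <= k < maxn I K) u i k)%:E <= _); last by rewrite lee_fin.
under eq_bigr do rewrite sumEFin.
rewrite sumEFin lee_fin exchange_big/=.
have grow (f : nat -> R) n N : (forall k, 0 <= f k)%R -> (n <= N)%N ->
    (\sum_(0 <= k < n) f k <= \sum_(0 <= k < N) f k)%R.
  by move=> f0 nN; rewrite (@big_cat_nat _ _ _ n 0%N N)//= lerDl sumr_ge0.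
apply: le_trans (grow _ _ _ _ (leq_maxl I K)); last first.
  by move=> i; rewrite sumr_ge0.
by rewrite ler_sum// => i _; apply: grow => //; rewrite leq_maxr.
Qed.

Lemma glued_integral_le (f : T * T -> R) (c : nat -> nat -> R) (b : R) :
  measurable_fun setT f -> (forall z, 0 <= f z)%R ->
  (forall y z, f (y, z) <= c (q y) (q z))%R -> (forall i k, 0 <= c i k)%R ->
  (forall F, \sum_(0 <= i < F) \sum_(0 <= k < F) p i k * c i k <= b)%R ->
  \int[glued]_z (f z)%:E <= b%:E.
Proof.
move=> mf f0 fc c0 pb.
have mfE : measurable_fun setT (EFin \o f) by exact/measurable_EFinP.
have fE0 z : setT z -> 0 <= (f z)%:E by rewrite lee_fin.
have pc0 i k : (0 <= p i k * c i k)%R by rewrite mulr_ge0.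
apply: (@le_trans _ _ (\sum_(i <oo) \sum_(k <oo) (p i k * c i k)%:E)); last first.
  exact: nneseries2_le.
rewrite ge0_integral_measure_series//.
apply: lee_nneseries => [i _ _|i _]; first by apply: integral_ge0.
rewrite ge0_integral_measure_series//.
apply: lee_nneseries => [k _ _|k _]; first by apply: integral_ge0.
rewrite ge0_integral_mscale//= -(densK i k).
rewrite (_ : (_ * _ * c i k)%:E = (dens i k)%:E * (m mu i * m nu k * c i k)%:E);
  last by rewrite -[RHS]EFinM; congr EFin; exact: (esym (mulrA _ _ _)).
apply: lee_wpmul2l; first by rewrite lee_fin.
pose r := mrestr (mu \x nu) (mblock i k).
have rC : r (~` block i k) = 0 by rewrite /r /mrestr setICl measure0.
have rB : r (block i k) = (m mu i * m nu k)%:E.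
  rewrite /r /mrestr setIid product_measure1E; [|exact: mq|exact: mq].
  by rewrite EFinM -!mE.
rewrite -(setUv (block i k)) ge0_integral_setU//=; last 4 first.
- exact: measurableC.
- by rewrite setUv.
- by move=> z _; exact: fE0.
- by rewrite disj_set2E setICr.
rewrite (null_set_integral (N := ~` _))//; last 2 first.
- exact: measurableC.
- exact: measurable_funTS.
rewrite adde0 (@le_trans _ _ (\int[r]_(z in block i k) (c i k)%:E))//.
  apply: ge0_le_integral => //.
  - by move=> z _; exact: fE0.
  - exact: measurable_funTS.
  - by move=> [y z] [/= <- <-]; rewrite lee_fin.
rewrite integral_cst// (_ : _ (block i k) = (m mu i * m nu k)%:E); last exact: rB.
by rewrite -EFinM lee_fin mulrC.
Qed.

End glue.

(** * Solutions of the continuity equation yield couplings *)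

Section approximation.
Context {R : realType} {d : nat}.
Notation V := ('rV[R]_d * R)%type.
Implicit Types mu nu : {finite_measure set 'rV[R]_d -> \bar R}.

Lemma measurable_transport_integrand : measurable_fun setT
  (fun z : 'rV[R]_d * 'rV[R]_d => 2^-1 * sqnorm (z.1 - z.2)).
Proof.
have mc (i : 'I_d) : measurable_fun setT
    (fun z : 'rV[R]_d * 'rV[R]_d => (z.1 - z.2) ord0 i).
  under eq_fun do rewrite !mxE.
  apply: measurable_funB.
    exact: (measurableT_comp (measurable_coord i) measurable_fst).
  exact: (measurableT_comp (measurable_coord i) measurable_snd).
apply: measurable_funM; first exact: measurable_cst.
by apply: measurable_sum => i; exact: measurable_funM.
Qed.

Lemma tail_cvg0 mu (q : 'rV[R]_d -> nat) :
  (forall k, measurable [set y | q y = k]) ->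
  tail q mu F @[F --> \oo] --> 0.
Proof.
move=> mq.
have cells := measure_cells mq mu measurableT.
have S : (\sum_(0 <= k < F) (mass q mu k)%:E)%E @[F --> \oo] --> mu setT.
  rewrite -cells; under eq_fun do under eq_bigr do
    rewrite fineK ?fin_num_measure// -[X in mu X]setTI.
  by apply: is_cvg_nneseries => *; rewrite measure_ge0.
have {}S : \sum_(0 <= k < F) mass q mu k @[F --> \oo] --> fine (mu setT).
  rewrite -(@fineK _ (mu setT)) ?fin_num_measure// in S.
  have -> : (fun F => \sum_(0 <= k < F) mass q mu k) =
      fine \o (fun F => (\sum_(0 <= k < F) (mass q mu k)%:E)%E).
    by apply/funext => F; rewrite /= sumEFin.
  exact: fine_cvg S.
rewrite -[X in _ --> X](subrr (fine (mu setT))).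
by apply: cvgB => //; exact: cvg_cst.
Qed.

Lemma rate_cvg (e M : R) : (1 + t) * (final_time t * (1 + t)) * (e + 4 * t * M)
  + 4 * t * M @[t --> (0 : R)] --> e.
Proof.
pose f (t : R) : R^o :=
  (1 + t) * (final_time t * (1 + t)) * (e + 4 * t * M) + 4 * t * M.
have Cid : Ck 0 (fun t : R => t : R^o) by split => // t; exact: cvg_id.
have C1 : Ck 0 (fun t : R => 1 + t : R^o) by apply: CkD => //; exact: Ck_cst.
have Ct : Ck 0 (fun t : R => 4 * t * M : R^o).
  by apply: CkM; [apply: CkM => //|]; exact: Ck_cst.
have CF : Ck 0 (fun t : R => final_time t : R^o).
  by apply: CkD => //; apply: CkM => //; exact: Ck_expR.
have Cf : Ck 0 f.
  apply: CkD => //; apply: CkM; last by apply: CkD => //; exact: Ck_cst.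
  by apply: CkM => //; exact: CkM.
have fe : e = f 0 by rewrite /f /final_time expR0; ring.
rewrite [X in _ --> X]fe.
exact: (Ck_continuous Cf).
Qed.

(** The cells are the cubes of side [1 / c]; for this [c] the squared distance
    to the corner of the cube is at most [delta ^+ 2]. *)
Section with_quantizer.
Variables (mu nu : {finite_measure set 'rV[R]_d -> \bar R}).
Variables (rho : {measure set V -> \bar R}) (j : vmeasure R d V) (e delta : R).
Hypothesis mass_eq : mu setT = nu setT.
Hypothesis rho_j : density_flux rho j.
Hypothesis CE : continuity_equation mu nu rho j.
Hypothesis cost_le : (eulerian_cost rho j <= e%:E)%E.
Hypothesis delta01 : 0 < delta <= 1.

Let c : R := d.+1%:R / delta.
Let q (y : 'rV[R]_d) : nat := pickle (grid c y).
Let x (k : nat) : 'rV[R]_d := if unpickle k is Some g then grid_point c g else 0.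

Let delta0 : 0 < delta. Proof. by case/andP: delta01. Qed.

Let c0 : 0 < c. Proof. by rewrite divr_gt0// ltr0n. Qed.

Let mq k : measurable [set y | q y = k].
Proof.
have m1 : measurable [set true] by [].
have := @measurable_fun_countable _ _ _ _ _ (grid c (d := d))
  (fun g : 'rV[int]_d => pickle g == k)
  (fun g => measurable_grid_fiber (X := id) c g (@measurable_coord R d)) measurableT _ m1.
by rewrite setTI; congr measurable; apply/seteqP; split => y /eqP.
Qed.

Let near_center y : sqnorm (y - x (q y)) <= delta ^+ 2.
Proof.
rewrite /x /q pickleK -sqnormN opprB.
have coord i : (grid_point c (grid c y) - y) ord0 i ^+ 2 <= c^-1 ^+ 2.
  rewrite -(real_normK (num_real _)) ler_sqr ?nnegrE ?normr_ge0 ?invr_ge0 ?(ltW c0)//.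
  exact: grid_point_dist.
apply: (@le_trans _ _ (\sum_(i < d) c^-1 ^+ 2)).
  by rewrite ler_sum// => i _; rewrite -expr2.
rewrite sumr_const card_ord -mulr_natr.
have -> : c^-1 ^+ 2 * d%:R = delta ^+ 2 * (d%:R / d.+1%:R ^+ 2).
  by rewrite /c; field; rewrite nat1r pnatr_eq0 (gt_eqF delta0).
rewrite ler_piMr ?sqr_ge0// ler_pdivrMr ?exprn_gt0 ?ltr0n// mul1r -natrX ler_nat.
by rewrite -mulnn mulSn (leq_trans (leqnSn d))// leq_addr.
Qed.

Lemma approximate_coupling_delta :
  exists gam : {measure set ('rV[R]_d * 'rV[R]_d) -> \bar R},
  coupling mu nu gam /\
  (transport_cost gam <= ((1 + delta) * (final_time delta * (1 + delta)) *
     (e + 4 * delta * fine (mu setT)) + 4 * delta * fine (mu setT))%:E)%E.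
Proof.
set M := fine (mu setT).
have [p [p0 pF]] := countable_coupling mass_eq rho_j CE cost_le delta01 mq near_center.
have marginal (n n' : {finite_measure set 'rV[R]_d -> \bar R}) (s : nat -> R) i :
    (forall F, (i < F)%N ->
       mass q n i - tail q n' F <= \sum_(0 <= k < F) s k <= mass q n i) ->
    (\sum_(k <oo) (s k)%:E)%E = n [set y | q y = i].
  move=> sF.
  have -> : n [set y | q y = i] = (mass q n i)%:E.
    by rewrite fineK// fin_num_measure.
  apply: cvg_lim => //; under eq_fun do rewrite sumEFin.
  apply: cvg_EFin; first exact: nearW.
  have lo : mass q n i - tail q n' F @[F --> \oo] --> mass q n i.
    by rewrite -[X in _ --> X]subr0; apply: cvgB; [exact: cvg_cst|exact: tail_cvg0].
  apply: (squeeze_cvgr _ lo (cvg_cst _)).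
  by exists i.+1 => // F /= iF; exact: sF.
have prow i : (\sum_(k <oo) (p i k)%:E)%E = mu [set y | q y = i].
  by apply: (marginal mu nu) => F iF; have [H _ _] := pF F; exact: H.
have pcol k : (\sum_(i <oo) (p i k)%:E)%E = nu [set y | q y = k].
  by apply: (marginal nu mu (fun i => p i k)) => F kF; have [_ H _] := pF F; exact: H.
exists (glued mu nu mq p0); split.
  by move=> A mA; exact: glued_marginals.
apply: (@glued_integral_le _ _ _ _ _ _ _ mq p0 prow pcol _
  (fun i k => (1 + delta) * (sqnorm (x i - x k) / 2) + 4 * delta)).
- exact: measurable_transport_integrand.
- by move=> z; rewrite mulr_ge0// ?sqnorm_ge0// invr_ge0.
- move=> y z /=.
  have -> : y - z = (x (q y) - x (q z)) + ((y - x (q y)) - (z - x (q z))).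
    by apply/rowP => i; rewrite !mxE; ring.
  have h1 := sqnorm_young (x (q y) - x (q z))
    ((y - x (q y)) - (z - x (q z))) delta0.
  have h2 := sqnorm_young (y - x (q y)) (- (z - x (q z))) (ltr01 : 0 < (1 : R)).
  rewrite sqnormN invr1 in h2.
  have ny := near_center y; have nz := near_center z.
  have h3 : (1 + delta^-1) * sqnorm ((y - x (q y)) - (z - x (q z))) <=
      (1 + delta^-1) * (4 * delta ^+ 2).
    by rewrite ler_wpM2l ?addr_ge0 ?invr_ge0 ?(ltW delta0)//; lra.
  have h4 : (1 + delta^-1) * (4 * delta ^+ 2) = 4 * delta ^+ 2 + 4 * delta.
    by field; rewrite gt_eqF.
  have h5 : delta ^+ 2 <= delta by move/andP : delta01 => [? ?]; nra.
  rewrite mulrC; lra.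
- move=> i k; rewrite addr_ge0// ?mulr_ge0//.
  + by rewrite addr_ge0 ?(ltW delta0).
  + by rewrite sqnorm_ge0.
  + by rewrite ltW.
- move=> F; have [rows _ pc] := pF F.
  have F0 : 0 < final_time delta * (1 + delta).
    rewrite mulr_gt0 ?addr_gt0// ?mulr_gt0 ?expR_gt0 ?addr_gt0//.
  have -> : \sum_(0 <= i < F) \sum_(0 <= k < F)
        p i k * ((1 + delta) * (sqnorm (x i - x k) / 2) + 4 * delta) =
      (1 + delta) * (final_time delta * (1 + delta)) *
        (\sum_(0 <= i < F) \sum_(0 <= k < F)
           p i k * (cost_factor delta * (sqnorm (x i - x k) / 2))) +
      4 * delta * \sum_(0 <= i < F) \sum_(0 <= k < F) p i k.
    rewrite !mulr_sumr -big_split/=; apply: eq_bigr => i _.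
    rewrite !mulr_sumr -big_split/=; apply: eq_bigr => k _.
    rewrite /cost_factor; field.
    by move: F0; apply: contraTT; rewrite negb_and !negbK => /orP[] /eqP ->;
      rewrite ?(mul0r, mulr0) ltxx.
  apply: lerD.
    by rewrite ler_wpM2l// mulr_ge0 ?(ltW F0)// addr_ge0 ?(ltW delta0).
  rewrite ler_wpM2l ?mulr_ge0 ?(ltW delta0)//.
  apply: (@le_trans _ _ (\sum_(0 <= i < F) mass q mu i)).
    rewrite !big_mkord ler_sum// => i _.
    by have /andP[_] := rows i (ltn_ord i).
  rewrite -lee_fin -sumEFin /M fineK ?fin_num_measure//.
  rewrite -(measure_cells mq mu measurableT).
  apply: le_trans (nneseries_lim_ge F _); last by move=> *; rewrite measure_ge0.
  rewrite le_eqVlt; apply/orP; left; apply/eqP; apply: eq_bigr => i _.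
  by rewrite setTI fineK// fin_num_measure.
Qed.

End with_quantizer.

(** The inequality between transport cost and Eulerian cost, for arbitrary
    solutions of the continuity equation: the bounds of
    [approximate_coupling_delta] tend to [e] as [delta] tends to zero. *)
Lemma approximate_coupling mu nu (rho : {measure set V -> \bar R})
    (j : vmeasure R d V) (e eps : R) :
  mu setT = nu setT -> density_flux rho j -> continuity_equation mu nu rho j ->
  (eulerian_cost rho j <= e%:E)%E -> 0 < eps ->
  exists gam : {measure set ('rV[R]_d * 'rV[R]_d) -> \bar R},
    coupling mu nu gam /\ (transport_cost gam <= (e + eps)%:E)%E.
Proof.
move=> mass_eq rho_j CE cost_le eps0.
pose B (t : R) := (1 + t) * (final_time t * (1 + t)) * (e + 4 * t * fine (mu setT))
  + 4 * t * fine (mu setT).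
have near_e : \forall t \near (0 : R), `|e - B t| <= eps.
  have Be : B t @[t --> (0 : R)] --> e by exact: rate_cvg.
  by move/cvgrPdist_le : Be => /(_ _ eps0).
have [t [t0 t1 et]] : exists t : R, [/\ 0 < t, t <= 1 & `|e - B t| <= eps].
  near ((0 : R)^'+) => t; exists t; split.
  - by near: t; exact: nbhs_right_gt.
  - by near: t; exact: nbhs_right_le.
  - by near: t; exact: cvg_within near_e.
have t01 : 0 < t <= 1 by rewrite t0 t1.
have [gam [cgam gam_le]] := approximate_coupling_delta mass_eq rho_j CE cost_le t01.
exists gam; split=> //; apply: le_trans gam_le _; rewrite lee_fin.
by move: et; rewrite ler_norml -/(B t) => /andP[]; lra.
Unshelve. all: by end_near. Qed.

End approximation.

(** * Integration along segments *)

Section path.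
Local Open Scope ereal_scope.
Context {R : realType} {d : nat}.
Notation V := ('rV[R]_d * R)%type.
Notation W := ('rV[R]_d * 'rV[R]_d)%type.
Notation lam := (@lebesgue_measure R).
Variable gam : {finite_measure set W -> \bar R}.

(** A segment of length [`|b - a|] spends at most the time [2 r / `|b - a|] in
    the slab of half-width [r]. The flux of a compactly supported field along
    segments is therefore integrable even if their mean length is infinite. *)
Lemma chord_integral (a b r C : R) (h : R -> R) : (0 <= r)%R -> (0 <= C)%R ->
  measurable_fun setT h -> (forall t, `|h t| <= C)%R ->
  (forall t, r < `|(1 - t) * a + t * b| -> h t = 0)%R ->
  \int[lam]_t `|(h t * (b - a))%:E| <= (2 * r * C)%:E.
Proof.
move=> r0 C0 mh hC hr.
have [->|ab] := eqVneq a b.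
  rewrite integral0_eq; first by rewrite lee_fin !mulr_ge0.
  by move=> t _; rewrite subrr mulr0 abse0.
have ba0 : (0 < `|b - a|)%R by rewrite normr_gt0 subr_eq0 eq_sym.
pose c := (- a / (b - a))%R; pose s := (r / `|b - a|)%R.
have s0 : (0 <= s)%R by rewrite divr_ge0.
have out t : ~ `[(c - s)%R, (c + s)%R]%classic t -> h t = 0%R.
  move=> tI; apply: hr; rewrite ltNge; apply/negP => tr; apply: tI.
  rewrite /= in_itv/= -ler_distlC distrC.
  have -> : (t - c = ((1 - t) * a + t * b) / (b - a))%R.
    by rewrite /c; field; rewrite subr_eq0 eq_sym.
  by rewrite normrM normfV ler_wpM2r// invr_ge0 ltW.
pose I := `[(c - s)%R, (c + s)%R]%classic.
have mI : measurable I by exact: measurable_itv.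
apply: (@le_trans _ _ (\int[lam]_t ((C * `|b - a|)%:E * (\1_I t)%:E))).
  apply: ge0_le_integral => //.
  - apply: measurableT_comp => //; apply/measurable_EFinP.
    by apply: measurable_funM => //; exact: measurable_cst.
  - by apply: measurable_funeM; exact/measurable_EFinP.
  - move=> t _; rewrite indicE; have [tI|/out tI] := pselect (I t).
      by rewrite mem_set// mule1 lee_fin normrM ler_wpM2r.
    by rewrite tI mul0r abse0 mule_ge0// lee_fin ?mulr_ge0.
rewrite ge0_integralZl//; last 2 first.
- exact/measurable_EFinP.
- by rewrite lee_fin mulr_ge0.
have lamI := @lebesgue_measure_itv R `[(c - s)%R, (c + s)%R].
rewrite integral_indic// setIT.
apply: (@le_trans _ _ ((C * `|b - a|)%:E * lam I)); first exact: lexx.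
rewrite lamI /= lte_fin.
case: ifPn => [_|]; last by rewrite mule0 lee_fin !mulr_ge0.
rewrite -EFinB -EFinM lee_fin /s.
by rewrite le_eqVlt; apply/orP; left; apply/eqP; field; rewrite gt_eqF.
Qed.

(** The indicator of the unit interval turns the integrals over [[0, 1]] into
    integrals over a whole product space. *)
Definition unit_time (t : R) : R := \1_(`[0%R, 1%R]) t.

Lemma measurable_interp (i : 'I_d) :
  measurable_fun setT (fun w : R * W => interp w.1 w.2 ord0 i).
Proof.
under eq_fun do rewrite !mxE.
have m1 : measurable_fun setT (fun w : R * W => w.2.1 ord0 i).
  apply: (measurableT_comp (measurable_coord i)).
  exact: (measurableT_comp measurable_fst measurable_snd).
have m2 : measurable_fun setT (fun w : R * W => w.2.2 ord0 i).
  apply: (measurableT_comp (measurable_coord i)).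
  exact: (measurableT_comp measurable_snd measurable_snd).
apply: measurable_funD; apply: measurable_funM => //.
by apply: measurable_funB => //; exact: measurable_cst.
Qed.

Lemma measurable_on_path (g : V -> R) : continuous g ->
  measurable_fun setT (fun w : R * W => g (interp w.1 w.2, w.1)).
Proof.
move=> cg.
exact: (measurable_continuous_comp cg measurable_interp measurable_fst).
Qed.

Lemma measurable_unit_time : measurable_fun setT (fun w : R * W => unit_time w.1).
Proof.
apply: (measurableT_comp _ measurable_fst).
by apply: measurable_indic; exact: measurable_itv.
Qed.

Lemma integrable_of_inner_bound (f : R * W -> \bar R) (B : R) :
  measurable_fun setT f -> (forall z, \int[lam]_t `|f (t, z)| <= B%:E) ->
  (lam \x gam).-integrable setT f.
Proof.
move=> mf fB; apply/integrable21ltyP => //.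
apply: (@le_lt_trans _ _ (\int[gam]_z B%:E)).
  apply: ge0_le_integral => //.
  - by move=> z _; apply: integral_ge0.
  - apply: (@measurable_fun_fubini_tonelli_G _ _ _ _ _ lam (abse \o f)) => //.
      exact: measurableT_comp.
    by move=> w; exact: abse_ge0.
have -> : \int[gam]_z B%:E = B%:E * gam setT.
  exact: (integral_cst gam measurableT).
by rewrite -(fineK (fin_num_measure gam _ measurableT)) -EFinM ltry.
Qed.

Lemma unit_time01 t : (0 <= unit_time t <= 1)%R.
Proof. by rewrite /unit_time indicE; case: (_ \in _); rewrite /= ?lexx ler01. Qed.

Lemma integrable_path_density (g : V -> R) (C : R) :
  continuous g -> (forall z, `|g z| <= C)%R ->
  (lam \x gam).-integrable setT
    (fun w => (g (interp w.1 w.2, w.1) * unit_time w.1)%:E).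
Proof.
move=> cg gC.
have C0 : (0 <= C)%R by exact: (le_trans (normr_ge0 _) (gC 0%R)).
have mI : measurable (`[0%R, 1%R]%classic : set R) by exact: measurable_itv.
have mF : measurable_fun setT
    (fun w : R * W => (g (interp w.1 w.2, w.1) * unit_time w.1)%:E).
  apply/measurable_EFinP; apply: measurable_funM; first exact: measurable_on_path.
  exact: measurable_unit_time.
apply: (@integrable_of_inner_bound _ C) => // z.
apply: (@le_trans _ _ (\int[lam]_t (C%:E * (unit_time t)%:E))).
  apply: ge0_le_integral => //.
  - apply: measurableT_comp => //.
    exact: (measurableT_comp mF (measurable_pair2 z)).
  - apply: measurable_funeM; apply/measurable_EFinP.
    exact: measurable_indic.
  - move=> t _ /=; rewrite -EFinM lee_fin normrM; have /andP[u0 _] := unit_time01 t.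
    by rewrite (ger0_norm u0) ler_wpM2r.
rewrite ge0_integralZl//; last 2 first.
- by apply/measurable_EFinP; exact: measurable_indic.
- by move=> t _; rewrite lee_fin; case/andP: (unit_time01 t).
rewrite integral_indic// setIT.
apply: (@le_trans _ _ (C%:E * lam `[0%R, 1%R]%classic)); first exact: lexx.
by rewrite lebesgue_measure_itv/= lte_fin ltr01 -EFinB subr0 mule1.
Qed.

Lemma integrable_path_flux (g : V -> R) (r C : R) (i : 'I_d) :
  continuous g -> (forall z, `|g z| <= C)%R -> (0 <= r)%R ->
  (forall (z : V) k, r < `|z.1 ord0 k| -> g z = 0)%R ->
  (lam \x gam).-integrable setT (fun w =>
    (g (interp w.1 w.2, w.1) * (w.2.2 - w.2.1) ord0 i * unit_time w.1)%:E).
Proof.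
move=> cg gC r0 gr.
have C0 : (0 <= C)%R by exact: (le_trans (normr_ge0 _) (gC 0%R)).
have mI : measurable (`[0%R, 1%R]%classic : set R) by exact: measurable_itv.
have md : measurable_fun setT (fun w : R * W => (w.2.2 - w.2.1)%R ord0 i).
  under eq_fun do rewrite !mxE.
  apply: measurable_funB; apply: (measurableT_comp (measurable_coord i)).
    exact: (measurableT_comp measurable_snd measurable_snd).
  exact: (measurableT_comp measurable_fst measurable_snd).
have mF : measurable_fun setT (fun w : R * W =>
    (g (interp w.1 w.2, w.1) * (w.2.2 - w.2.1) ord0 i * unit_time w.1)%:E).
  apply/measurable_EFinP; apply: measurable_funM; last exact: measurable_unit_time.
  by apply: measurable_funM => //; exact: measurable_on_path.
apply: (@integrable_of_inner_bound _ (2 * r * C)) => // z.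
have mh : measurable_fun setT (fun t => g (interp t z, t) * unit_time t)%R.
  apply: measurable_funM; last exact: measurable_indic.
  exact: (measurableT_comp (measurable_on_path cg) (measurable_pair2 z)).
have hC t : (`|g (interp t z, t) * unit_time t| <= C)%R.
  have /andP[u0 u1] := unit_time01 t.
  rewrite normrM (ger0_norm u0) (le_trans (ler_wpM2r u0 (gC _)))//.
  by rewrite ler_piMr.
have hr t : (r < `|(1 - t) * z.1 ord0 i + t * z.2 ord0 i|)%R ->
    (g (interp t z, t) * unit_time t = 0)%R.
  move=> tr; rewrite (gr _ i) ?mul0r//=.
  by rewrite /interp !mxE.
have := chord_integral r0 C0 mh hC hr.
apply: le_trans; rewrite le_eqVlt; apply/orP; left; apply/eqP.
by apply: eq_integral => t _; rewrite !mxE mulrAC.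
Qed.

Lemma path_fubini (f : R -> W -> R) :
  (lam \x gam).-integrable setT (fun w => (f w.1 w.2 * unit_time w.1)%:E) ->
  \int[lam]_(t in `[0%R, 1%R]) \int[gam]_z (f t z)%:E =
  \int[gam]_z \int[lam]_(t in `[0%R, 1%R]) (f t z)%:E.
Proof.
move=> intf; have /= F := Fubini intf.
transitivity (\int[lam]_t \int[gam]_z (f t z * unit_time t)%:E).
  rewrite integral_mkcond; apply: eq_integral => t _.
  rewrite /unit_time indicE patchE; case: ifPn => tI /=.
    by under [RHS]eq_integral do rewrite mulr1.
  by under [RHS]eq_integral do rewrite mulr0; rewrite integral0.
rewrite F; apply: eq_integral => z _.
rewrite [RHS]integral_mkcond; apply: eq_integral => t _.
by rewrite /unit_time indicE patchE; case: ifPn => tI /=; rewrite ?mulr1 ?mulr0.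
Qed.

Lemma path_integrable (f : R -> W -> R) :
  (lam \x gam).-integrable setT (fun w => (f w.1 w.2 * unit_time w.1)%:E) ->
  gam.-integrable setT (fun z => \int[lam]_(t in `[0%R, 1%R]) (f t z)%:E).
Proof.
move=> intf; have mf := measurable_int _ intf.
set F := (fun w => _) in intf mf.
have GE z : \int[lam]_(t in `[0%R, 1%R]) (f t z)%:E = \int[lam]_t F (t, z).
  rewrite integral_mkcond; apply: eq_integral => t _.
  by rewrite /F /unit_time /= indicE patchE; case: ifPn => tI /=; rewrite ?mulr1 ?mulr0.
under eq_fun do rewrite GE.
apply/integrableP; split.
  exact: measurable_fubini_G intf.
have := (integrable21ltyP lam gam mf).1 intf; apply: le_lt_trans.
apply: ge0_le_integral => //.
- by apply: measurableT_comp => //; exact: measurable_fubini_G intf.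
- apply: (@measurable_fun_fubini_tonelli_G _ _ _ _ _ lam (abse \o F)) => //.
    exact: measurableT_comp.
  by move=> w; exact: abse_ge0.
- move=> z _; apply: le_abse_integral => //.
  exact: (measurableT_comp mf (measurable_pair2 z)).
Qed.

End path.

(** * The Eulerian description in terms of segments *)

Lemma continuous_pair (T U1 U2 : topologicalType) (f : T -> U1) (g : T -> U2) :
  continuous f -> continuous g -> continuous (fun x => (f x, g x)).
Proof.
move=> cf cg x.
exact: (@cvg_pair _ _ _ (nbhs x) (nbhs (f x)) (nbhs (g x)) _ _ _ f g (cf x) (cg x)).
Qed.

Section description.
Local Open Scope ereal_scope.
Context {R : realType} {d : nat}.
Notation V := ('rV[R]_d * R)%type.
Notation W := ('rV[R]_d * 'rV[R]_d)%type.
Notation lam := (@lebesgue_measure R).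
Variable gam : {finite_measure set W -> \bar R}.
Variables (rho : {measure set V -> \bar R}) (j : vmeasure R d V).
Hypothesis descr : eulerian_description gam rho j.

Lemma Cc_slice (U : normedModType R) (f : V -> U) (t : R) :
  (0 <= t <= 1)%R -> Cc (@strip R d) f -> Cc setT (fun x => f (x, t)).
Proof.
move=> t01 [cf [K [cK Ks fK]]]; have [r r0 Kr] := compact_strip_box cK.
have xt x : strip (x, t) by split => //=; rewrite in_itv.
split.
  apply: continuous_subspaceT => x.
  have -> : (fun x => f (x, t)) = (f \o clamp) \o (fun x => (x, t)).
    by apply/funext => y; rewrite /= clamp_id.
  apply: continuous_comp; last exact: (clamp_comp_continuous cf).
  have cp : continuous (fun x : 'rV[R]_d => (x, t) : V).
    by apply: continuous_pair => y; [exact: cvg_id|exact: cst_continuous].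
  exact: cp.
exists [set x : 'rV[R]_d | forall i, `[(- r)%R, r]%classic (x ord0 i)]; split => //.
  have cI : compact `[(- r)%R, r]%classic by exact: segment_compact.
  exact: (@rV_compact _ d (fun=> `[(- r)%R, r]%classic) (fun=> cI)).
move=> x _ nx; apply: fK => // /Kr[/= xr _]; apply: nx => i /=.
by rewrite in_itv/= -ler_norml.
Qed.

Lemma path_strip (t : R) (z : W) : (0 <= t <= 1)%R -> strip (interp t z, t).
Proof. by move=> t01; split => //=; rewrite in_itv. Qed.

Lemma path_continuous (z : W) : continuous (fun t : R => (interp t z, t) : V).
Proof.
apply: continuous_pair => [|t]; last exact: cvg_id.
apply: rV_continuous => i t; under eq_fun do rewrite !mxE.
apply: cvgD; apply: cvgMr_tmp; last exact: cvg_id.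
by apply: cvgB; [exact: cvg_cst|exact: cvg_id].
Qed.

Lemma integrable_in_time (f : V -> R) (z : W) : Cc (W := R^o) (@strip R d) f ->
  lam.-integrable `[0%R, 1%R] (fun t => (f (interp t z, t))%:E).
Proof.
move=> [cf _].
have cg : continuous (fun t : R => (f \o clamp) (interp t z, t) : R^o).
  move=> t; apply: (@continuous_comp _ _ _ (fun t => (interp t z, t)) (f \o clamp)).
    exact: path_continuous.
  exact: (clamp_comp_continuous cf).
have : lam.-integrable `[0%R, 1%R] (EFin \o (fun t => (f \o clamp) (interp t z, t))).
  apply: continuous_compact_integrable; first exact: segment_compact.
  exact: continuous_subspaceT.
apply: eq_integrable => // t; rewrite inE/= in_itv/= => t01.
by rewrite clamp_id//; exact: path_strip.
Qed.

Let in01 (t : R) : t \in `[0%R, 1%R]%classic -> (0 <= t <= 1)%R.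
Proof. by rewrite inE/= in_itv. Qed.

(** Fubini's theorem applied to the description of [rho] by its slices. *)
Lemma density_on_paths (f : V -> R) : Cc (W := R^o) (@strip R d) f ->
  \int[rho]_(z in @strip R d) (f z)%:E =
  \int[gam]_z \int[lam]_(t in `[0%R, 1%R]) (f (interp t z, t))%:E /\
  gam.-integrable setT (fun z => \int[lam]_(t in `[0%R, 1%R]) (f (interp t z, t))%:E).
Proof.
move=> Cf; have [_ [rho_ [j_ [slices rhoE _]]]] := descr.
have [g [r [C [cg gf r0 gC gr]]]] := Cc_strip_extension Cf.
have I := integrable_path_density gam cg gC.
have fg z : \int[lam]_(t in `[0%R, 1%R]) (f (interp t z, t))%:E =
    \int[lam]_(t in `[0%R, 1%R]) (g (interp t z, t))%:E.
  by apply: eq_integral => t /in01 t01; rewrite gf//; exact: path_strip.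
split; last first.
  under eq_fun do rewrite fg.
  exact: (path_integrable (f := fun t z => g (interp t z, t))).
under [RHS]eq_integral do rewrite fg.
rewrite rhoE// -(path_fubini (f := fun t z => g (interp t z, t))) //.
apply: eq_integral => t /in01 t01; have [_ _ slice _] := slices t t01.
rewrite (slice (fun x => f (x, t))); last exact: Cc_slice.
by apply: eq_integral => z _; rewrite gf//; exact: path_strip.
Qed.

Lemma flux_on_paths (xi : V -> 'rV[R]_d) : Cc (@strip R d) xi ->
  vintegral j (@strip R d) xi = \int[gam]_z
    \int[lam]_(t in `[0%R, 1%R]) (dotv (xi (interp t z, t)) (z.2 - z.1))%:E /\
  gam.-integrable setT (fun z =>
    \int[lam]_(t in `[0%R, 1%R]) (dotv (xi (interp t z, t)) (z.2 - z.1))%:E).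
Proof.
move=> Cxi; have [_ [rho_ [j_ [slices _ jE]]]] := descr.
have /choice[g gP] : forall i, exists g : V -> R,
    (forall z, strip z -> g z = xi z ord0 i) /\
    (lam \x gam).-integrable setT (fun w : R * W =>
      (g (interp w.1 w.2, w.1) * (w.2.2 - w.2.1)%R ord0 i * unit_time w.1)%:E).
  move=> i; have [g [r [C [cg gf r0 gC gr]]]] := Cc_strip_extension (Cc_coord i Cxi).
  by exists g; split => //; exact: integrable_path_flux gr.
pose F t (z : W) := (\sum_i g i (interp t z, t) * (z.2 - z.1)%R ord0 i)%R.
have I : (lam \x gam).-integrable setT (fun w => (F w.1 w.2 * unit_time w.1)%:E).
  rewrite /F; under eq_fun do rewrite mulr_suml -sumEFin.
  by apply: integrable_sum => // i _; exact: (gP i).2.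
have FE t z : (0 <= t <= 1)%R -> dotv (xi (interp t z, t)) (z.2 - z.1) = F t z.
  by move=> t01; apply: eq_bigr => i _; rewrite (gP i).1//; exact: path_strip.
have fg z : \int[lam]_(t in `[0%R, 1%R]) (dotv (xi (interp t z, t)) (z.2 - z.1))%:E =
    \int[lam]_(t in `[0%R, 1%R]) (F t z)%:E.
  by apply: eq_integral => t /in01 t01; rewrite FE.
split; last first.
  by under eq_fun do rewrite fg; exact: path_integrable.
under [RHS]eq_integral do rewrite fg.
rewrite jE// -path_fubini //.
apply: eq_integral => t /in01 t01; have [_ _ _ slice] := slices t t01.
rewrite (slice (fun x => xi (x, t))); last exact: Cc_slice.
by apply: eq_integral => z _; rewrite FE.
Qed.

End description.

(** * Directional derivatives *)

Section directional.
Context {R : realType} {U : normedModType R}.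
Variable f : U -> R^o.
Hypothesis df : forall x v, derivable f x v.
Hypothesis cdf : forall v, continuous ('D_v f).

Lemma is_derive_along (v y : U) (s : R) :
  is_derive s (1 : R) (fun s => f (s *: v + y)) ('D_v f (s *: v + y)).
Proof.
have /is_derive_line D := derivableP (@df (s *: v + y) v).
have Ds : is_derive s (1 : R) (fun t : R => t - s) 1.
  apply: (is_derive_eq (is_deriveB (is_derive_id s (1 : R))
    (is_derive_cst s s (1 : R)))).
  by rewrite subr0.
have -> : (fun t : R => f (t *: v + y)) =
    (fun h : R => f (h *: v + (s *: v + y))) \o (fun t => t - s).
  by apply/funext => t; rewrite /= addrA -scalerDl subrK.
rewrite -[X in is_derive _ _ _ X]mulr1.
apply: (@is_derive1_comp R (fun h : R => f (h *: v + (s *: v + y)))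
  (fun t => t - s)) => //.
by rewrite subrr.
Qed.

Lemma mean_value_along (v y : U) (h : R) : h != 0 -> exists2 c, `|c| <= `|h| &
  f (h *: v + y) - f y = 'D_v f (c *: v + y) * h.
Proof.
have cG (a b : R) : {within `[a, b], continuous (fun s : R => f (s *: v + y))}.
  apply: continuous_subspaceT => s; apply/differentiable_continuous.
  by apply/derivable1_diffP; case: (is_derive_along v y s).
have Gd a b : forall s : R, s \in `]a, b[ ->
    is_derive s (1 : R) (fun s => f (s *: v + y)) ('D_v f (s *: v + y)).
  by move=> s _; exact: is_derive_along.
rewrite neq_lt => /orP[h0|h0].
  have [c] := MVT h0 (Gd h 0) (cG h 0); rewrite in_itv/= => /andP[hc c0].
  rewrite scale0r add0r sub0r => E; exists c; last by rewrite -opprB E; ring.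
  by rewrite !ltr0_norm// lerN2 ltW.
have [c] := MVT h0 (Gd 0 h) (cG 0 h); rewrite in_itv/= => /andP[c0 ch].
rewrite scale0r add0r subr0 => E; exists c => //.
by rewrite !gtr0_norm// ltW.
Qed.

(** The mean value theorem along [v] and the continuity of ['D_v f]; this
    replaces the differentiability of [f] as a function of several variables. *)
Lemma is_derive_add (u v x : U) : is_derive x (u + v) f ('D_u f x + 'D_v f x).
Proof.
suff lim : h^-1 *: ((f \o shift x) (h *: (u + v)) - f x) @[h --> (0 : R)^'] -->
    ('D_u f x + 'D_v f x : R^o).
  apply: DeriveDef; first by apply/cvg_ex; exists ('D_u f x + 'D_v f x).
  exact/cvg_lim.
have lim_u : h^-1 *: ((f \o shift x) (h *: u) - f x) @[h --> (0 : R)^'] -->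
    ('D_u f x : R^o).
  exact: df.
have lim_v : h^-1 *: (f (h *: v + (h *: u + x)) - f (h *: u + x))
    @[h --> (0 : R)^'] --> ('D_v f x : R^o).
  apply/cvgrPdist_le => e e0.
  have /cvgrPdist_le/(_ _ e0)/nbhs_ballP[eta /= eta0 near_x] := @cdf v x.
  have uv0 : 0 < `|u| + `|v| + 1 by rewrite ltr_pwDr// addr_ge0.
  near=> h.
  have h0 : h != 0 by near: h; exact: nbhs_dnbhs_neq.
  have [c ch ->] := mean_value_along v (h *: u + x) h0.
  rewrite mulrC /GRing.scale/= mulKf//.
  apply: near_x; rewrite -ball_normE /ball_/=.
  rewrite addrA opprD addrCA subrr addr0 normrN (addrC (c *: v)).
  apply: (@le_lt_trans _ _ (`|h| * (`|u| + `|v| + 1))).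
    rewrite (le_trans (ler_normD _ _))// !normrZ.
    have : `|c| * `|v| <= `|h| * `|v| by rewrite ler_wpM2r.
    by have := normr_ge0 h; lra.
  rewrite -ltr_pdivlMr//.
  near: h; apply: dnbhs0_lt; exact: divr_gt0.
have -> : (fun h : R => h^-1 *: ((f \o shift x) (h *: (u + v)) - f x)) =
    (fun h : R => h^-1 *: ((f \o shift x) (h *: u) - f x)) \+
    (fun h : R => h^-1 *: (f (h *: v + (h *: u + x)) - f (h *: u + x))).
  apply/funext => h; rewrite /= -scalerDr; congr (_ *: _).
  by rewrite [RHS]addrC subrKA scalerDr [h *: u + h *: v]addrC addrA.
exact: cvgD lim_u lim_v.
Unshelve. all: by end_near. Qed.

Lemma derive_scale_dir (c : R) (v x : U) : 'D_(c *: v) f x = c * 'D_v f x.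
Proof.
apply: (@derive_val _ _ _ _ _ _ _ _); apply/is_derive_line.
have Dc : is_derive (0 : R) (1 : R) (fun h : R => h * c) c.
  apply: (is_derive_eq (is_deriveM (is_derive_id (0 : R) (1 : R))
    (is_derive_cst c (0 : R) (1 : R)))).
  by rewrite /GRing.scale/= mul0r add0r mulr1.
have -> : (fun h : R => f (h *: (c *: v) + x)) =
    (fun h : R => f (h *: v + x)) \o (fun h => h * c).
  by apply/funext => h; rewrite /= scalerA.
rewrite mulrC; apply: (@is_derive1_comp R (fun h : R => f (h *: v + x))) => //.
by rewrite mul0r; apply: (is_derive_line f x v _).1; exact: (derivableP (@df x v)).
Qed.

Lemma derive_sum_dir (I : Type) (s : seq I) (w : I -> U) (x : U) :
  'D_(\sum_(i <- s) w i) f x = \sum_(i <- s) 'D_(w i) f x.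
Proof.
elim: s => [|i s IH]; first by rewrite !big_nil derive0.
by rewrite !big_cons (@derive_val _ _ _ _ _ _ _ (is_derive_add _ _ _)) IH.
Qed.

End directional.

(** * Continuity equation and cost of the Eulerian description *)

Section main.
Context {R : realType} {d : nat}.
Notation V := ('rV[R]_d * R)%type.
Notation W := ('rV[R]_d * 'rV[R]_d)%type.
Notation lam := (@lebesgue_measure R).

Section smooth_path.
Variable f : V -> R.
Hypothesis Cf : Cc_smooth f.

Let df (x v : V) : derivable (f : V -> R^o) x v.
Proof. by have [sm _] := Cf; exact: (sm [::]).2. Qed.

Let cdf (v : V) : continuous ('D_v (f : V -> R^o)).
Proof. by have [/(_ [:: v])[cf _] _] := Cf; exact: cf. Qed.

Lemma derive_path_direction (w : 'rV[R]_d) (z : V) :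
  'D_((w, 1) : V) (f : V -> R^o) z =
  time_derivative f z + dotv (space_gradient f z) w.
Proof.
pose e (i : 'I_d) : V := (delta_mx ord0 i, 0).
have -> : ((w, 1) : V) = ((0, 1) : V) + \sum_i w ord0 i *: e i.
  have sumE : \sum_i w ord0 i *: e i = (w, 0).
    rewrite [LHS]surjective_pairing; congr pair.
      rewrite (@big_morph _ _ (fst : V -> _) 0 +%R 0 +%R)// [RHS]row_sum_delta.
      by apply: eq_bigr => i _.
    rewrite (@big_morph _ _ (snd : V -> _) 0 +%R 0 +%R)// big1// => i _.
    by rewrite /= scaler0.
  by rewrite sumE; congr pair; rewrite ?add0r ?addr0.
rewrite (@derive_val _ _ _ _ _ _ _ (is_derive_add df cdf _ _ _)).
congr (_ + _); rewrite (derive_sum_dir df cdf); apply: eq_bigr => i _.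
by rewrite (derive_scale_dir df) mxE mulrC.
Qed.

Lemma interp_line (t : R) (z : W) :
  (interp t z, t) = t *: ((z.2 - z.1, 1) : V) + (z.1, 0).
Proof.
congr pair; last by rewrite /= addr0 [RHS]mulr1.
by apply/rowP => i; rewrite !mxE; ring.
Qed.

(** By the chain rule the integrand is the derivative of [f] along the segment
    from [z.1] to [z.2]. *)
Lemma integral_along_path (z : W) :
  (\int[lam]_(t in `[0%R, 1%R]) (time_derivative f (interp t z, t) +
     dotv (space_gradient f (interp t z, t)) (z.2 - z.1))%:E =
   (f (z.2, 1%R))%:E - (f (z.1, 0%R))%:E)%E.
Proof.
pose F t := f (interp t z, t).
have dF t : is_derive t (1 : R) F (time_derivative f (interp t z, t) +
     dotv (space_gradient f (interp t z, t)) (z.2 - z.1)).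
  have := is_derive_along df ((z.2 - z.1, 1) : V) (z.1, 0) t.
  rewrite derive_path_direction -interp_line.
  by have -> : (fun s => f (s *: (z.2 - z.1, 1) + (z.1, 0))) = F
    by apply/funext => s; rewrite /F interp_line.
have cF : continuous F.
  by move=> t; apply/differentiable_continuous/derivable1_diffP; case: (dF t).
have -> : f (z.2, 1) = F 1.
  by rewrite /F /interp subrr scale0r add0r scale1r.
have -> : f (z.1, 0) = F 0.
  by rewrite /F /interp subr0 scale0r addr0 scale1r.
apply: (@continuous_FTC2 _ _ F 0 1 ltr01).
- apply: continuous_subspaceT.
  have -> : (fun t => time_derivative f (interp t z, t) +
      dotv (space_gradient f (interp t z, t)) (z.2 - z.1)) =
      'D_((z.2 - z.1, 1) : V) (f : V -> R^o) \o (fun t => (interp t z, t)).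
    by apply/funext => t; rewrite /= derive_path_direction.
  move=> t; apply: continuous_comp; [exact: path_continuous|exact: cdf].
- split=> [t _||]; first by case: (dF t).
  + by apply: cvg_at_right_filter; exact: cF.
  + by apply: cvg_at_left_filter; exact: cF.
- by move=> t _; rewrite derive1E; exact: derive_val.
Qed.

End smooth_path.

Local Open Scope ereal_scope.

Lemma integral_image d1 d2 (X : measurableType d1) (Y : measurableType d2)
    (m : {measure set X -> \bar R}) (n : {measure set Y -> \bar R}) (phi : X -> Y)
    (f : Y -> \bar R) : measurable_fun setT phi ->
  (forall A, measurable A -> n A = m (phi @^-1` A)) -> n.-integrable setT f ->
  \int[n]_y f y = \int[m]_x f (phi x) /\ m.-integrable setT (fun x => f (phi x)).
Proof.
move=> mphi nE intf; have mf := measurable_int _ intf.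
pose phi_mixin := isMeasurableFun.Build _ _ _ _ _ mphi.
pose phi_pack : {mfun X >-> Y} := MeasurableFun.Pack (MeasurableFun.Class phi_mixin).
have nE' (g : Y -> \bar R) : \int[n]_y g y = \int[pushforward m phi_pack]_y g y.
  by apply: eq_measure_integral => A mA _; rewrite nE.
have I : m.-integrable setT (f \o phi).
  apply/integrableP; split; first exact: measurableT_comp.
  have /integrableP[_] := intf; rewrite nE' ge0_integral_pushforward//.
  exact: measurableT_comp.
by split => //; rewrite nE' integral_pushforward.
Qed.

Section eulerian.
Variables (mu nu : {finite_measure set 'rV[R]_d -> \bar R}).
Variable gam : {finite_measure set W -> \bar R}.
Variables (rho : {measure set V -> \bar R}) (j : vmeasure R d V).
Hypothesis cpl : coupling mu nu gam.
Hypothesis descr : eulerian_description gam rho j.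

Let integral_first_marginal (f : 'rV[R]_d -> \bar R) :
  mu.-integrable setT f ->
  \int[mu]_x f x = \int[gam]_z f z.1 /\ gam.-integrable setT (fun z => f z.1).
Proof.
apply: integral_image; first exact: measurable_fst.
by move=> A mA; rewrite -(cpl mA).1; congr (gam _);
  apply/seteqP; split => z //= [].
Qed.

Let integral_second_marginal (f : 'rV[R]_d -> \bar R) :
  nu.-integrable setT f ->
  \int[nu]_x f x = \int[gam]_z f z.2 /\ gam.-integrable setT (fun z => f z.2).
Proof.
apply: integral_image; first exact: measurable_snd.
by move=> A mA; rewrite -(cpl mA).2; congr (gam _);
  apply/seteqP; split => z //= [].
Qed.

Lemma Cc_dotv (xi : V -> 'rV[R]_d) (w : 'rV[R]_d) : Cc (@strip R d) xi ->
  Cc (W := R^o) (@strip R d) (fun z => dotv (xi z) w).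
Proof.
move=> [cxi [K [cK KD xi0]]]; split.
  move=> z; apply: (@continuous_comp (subspace _) _ _ xi (fun v : 'rV[R]_d => dotv v w)).
    exact: cxi.
  apply: (@cvg_sum R _ _ (nbhs (xi z)) _
    (fun i (v : 'rV[R]_d) => v ord0 i * w ord0 i)%R) => i.
  by apply: cvgMr_tmp; exact: coord_continuous.
exists K; split => // z Dz Kz; rewrite xi0// /dotv big1// => i _.
by rewrite mxE mul0r.
Qed.

(** The fundamental theorem of calculus along each segment, integrated over
    the segments. *)
Lemma eulerian_continuity_equation : continuity_equation mu nu rho j.
Proof.
move=> f Cf; set w := fun z : W => (z.2 - z.1)%R.
have t0 : (0 <= (0 : R) <= 1)%R by rewrite lexx ler01.
have t1 : (0 <= (1 : R) <= 1)%R by rewrite lexx ler01.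
have [-> I1] := integral_first_marginal (integrable_slice mu Cf t0).
have [-> I2] := integral_second_marginal (integrable_slice nu Cf t1).
have [-> Id] := density_on_paths descr (Cc_time_derivative Cf).
have [-> If] := flux_on_paths descr (Cc_space_gradient Cf).
rewrite -integralD// -integralB//; apply: eq_integral => z _.
rewrite -(integral_along_path Cf z) -integralD//.
- exact: integrable_in_time (Cc_time_derivative Cf).
- exact: integrable_in_time (Cc_dotv _ (Cc_space_gradient Cf)).
Qed.

(** Young's inequality [xi . w - |xi|^2 / 2 <= |w|^2 / 2] at each time of each
    segment, whose velocity [w] is constant. *)
Lemma eulerian_cost_le_transport : eulerian_cost rho j <= transport_cost gam.
Proof.
apply: ge_ereal_sup => _ [xi Cxi <-].
have [-> Id] := density_on_paths descr (Cc_sqnorm Cxi).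
have [-> If] := flux_on_paths descr Cxi.
rewrite -integralB//.
have lam01 c : \int[lam]_(t in `[0%R, 1%R]) c%:E = c%:E :> \bar R.
  have m01 : measurable (`[0%R, 1%R]%classic : set R) by exact: measurable_itv.
  transitivity (c%:E * lam `[0%R, 1%R]%classic).
    exact: (integral_cst lam m01).
  by rewrite lebesgue_measure_itv/= lte_fin ltr01 -EFinB subr0 mule1.
have lam01_int c : lam.-integrable `[0%R, 1%R] (fun=> c%:E).
  apply: (continuous_compact_integrable (f := cst c)); first exact: segment_compact.
  by apply: continuous_subspaceT => t; exact: cvg_cst.
have le_pt z : \int[lam]_(t in `[0%R, 1%R])
      (dotv (xi (interp t z, t)) (z.2 - z.1))%:E -
    \int[lam]_(t in `[0%R, 1%R]) (sqnorm (xi (interp t z, t)) / 2)%:E <=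
    (2^-1 * sqnorm (z.1 - z.2))%:E.
  have Ix := integrable_in_time z (Cc_dotv (z.2 - z.1) Cxi).
  have Is := integrable_in_time z (Cc_sqnorm Cxi).
  rewrite -integralB// -[leRHS]lam01; apply: le_integral => //.
    exact: integrableB.
  move=> t _; rewrite -EFinB lee_fin -(sqnormN (z.1 - z.2)) opprB.
  set v := xi _; set w := (z.2 - z.1)%R.
  suff : (0 <= sqnorm (v - w))%R.
    have -> : (sqnorm (v - w) = sqnorm v + sqnorm w - 2 * dotv v w)%R.
      rewrite /sqnorm /dotv mulr_sumr -big_split/= -sumrB; apply: eq_bigr => i _.
      by rewrite !mxE; ring.
    by lra.
  exact: sqnorm_ge0.
(* The right-hand side is integrable only if the transport cost is finite. *)
have [fin|inf] := ltP (transport_cost gam) +oo; last first.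
  by rewrite (le_trans _ inf)// leey.
apply: le_integral => //.
- exact: integrableB.
- apply/integrableP; split.
    apply/measurable_EFinP; exact: measurable_transport_integrand.
  under eq_integral do rewrite gee0_abs ?lee_fin ?mulr_ge0 ?sqnorm_ge0 ?invr_ge0//.
  exact: fin.
Qed.

End eulerian.

End main.

(** * The variational inequalities *)

Local Open Scope ereal_scope.

Section finite_version.
Context d (T : measurableType d) (R : realType) (m : {measure set T -> \bar R}).
Hypothesis fin_m : fin_num_fun m.

(** The hypothesis is an argument of the definition, for the instance below to
    be found by unification. *)
Definition finite_version : set T -> \bar R := let _ := fin_m in m.

HB.instance Definition _ := Measure.copy finite_version m.

HB.instance Definition _ := Measure_isFinite.Build _ _ _ finite_version fin_m.

End finite_version.

Theorem lemma1p12 (R : realType) (d : nat)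
    (mu nu : {finite_measure set 'rV[R]_d -> \bar R})
    (gam : {measure set ('rV[R]_d * 'rV[R]_d) -> \bar R})
    (Delta : R)
    (rho : {measure set ('rV[R]_d * R) -> \bar R})
    (j : vmeasure R d ('rV[R]_d * R)%type)
    (gam_coupling : coupling mu nu gam)
    (gam_almost_minimal :
      forall gam' : {measure set ('rV[R]_d * 'rV[R]_d) -> \bar R},
        coupling mu nu gam' ->
        transport_cost gam <= transport_cost gam' + Delta%:E)
    (gam_eulerian : eulerian_description gam rho j) :
  transport_cost gam <= eulerian_cost rho j + Delta%:E /\
  forall (rho' : {measure set ('rV[R]_d * R) -> \bar R})
         (j' : vmeasure R d ('rV[R]_d * R)%type),
    density_flux rho' j' ->
    continuity_equation mu nu rho' j' ->
    eulerian_cost rho j <= eulerian_cost rho' j' + Delta%:E.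
Proof.
have massT : [set: 'rV[R]_d * 'rV[R]_d] = [set: 'rV[R]_d] `*` [set: 'rV[R]_d].
  by rewrite setXTT.
have mass_eq : mu setT = nu setT.
  by have [<- <-] := gam_coupling setT measurableT.
have fin_gam : fin_num_fun gam.
  apply: lty_fin_num_fun; rewrite massT (gam_coupling setT measurableT).1.
  by rewrite ltey_eq fin_num_measure.
pose gamF : {finite_measure set ('rV[R]_d * 'rV[R]_d)%type -> \bar R} :=
  finite_version fin_gam.
have lower (r : {measure set ('rV[R]_d * R) -> \bar R}) k :
    density_flux r k -> continuity_equation mu nu r k ->
    transport_cost gam <= eulerian_cost r k + Delta%:E.
  move=> rk CE; case E : (eulerian_cost r k) => [e| |].
  - apply/lee_addgt0Pr => eps eps0.
    have Ee : eulerian_cost r k <= e%:E by rewrite E.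
    have [g [cg gle]] := approximate_coupling mass_eq rk CE Ee eps0.
    apply: le_trans (gam_almost_minimal g cg) _.
    apply: (@le_trans _ _ ((e + eps)%:E + Delta%:E)); first exact: leeD.
    by rewrite EFinD addeAC.
  - by rewrite addye// leey.
  (* A negative cost would give a coupling of negative transport cost. *)
  - have Ee : eulerian_cost r k <= (- 2)%:E by rewrite E leNye.
    have [g [_ gle]] := approximate_coupling mass_eq rk CE Ee ltr01.
    have g0 : 0 <= transport_cost g.
      by apply: integral_ge0 => z _; rewrite lee_fin mulr_ge0// ?sqnorm_ge0// invr_ge0.
    have := le_trans g0 gle; rewrite lee_fin (_ : - 2 + 1 = -1 :> R)%R; last by ring.
    by rewrite ler0N1.
have CE := @eulerian_continuity_equation R d mu nu gamF rho j gam_coupling gam_eulerian.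
have upper := @eulerian_cost_le_transport R d gamF rho j gam_eulerian.
split; first exact: lower gam_eulerian.1 CE.
move=> rho' j' rk CE'; apply: le_trans upper _.
exact: lower.
Qed.
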